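(* Let $\alpha>0$, let $\{M(t)\}_{t\ge0}$ be a generalized counting process with positive rates $\lambda_1,\dots,\lambda_k$, and let $$\mathcal{M}^\alpha(t)=\frac1{\Gamma(\alpha)}\int_0^t(t-s)^{\alpha-1}M(s)\,\mathrm{d}s,\qquad t\ge0.$$ Then the variance of $\{\mathcal{M}^\alpha(t)\}_{t\ge0}$ is $$\operatorname{Var}(\mathcal{M}^\alpha(t))=\frac{c_2\,t^{2\alpha+1}}{(2\alpha+1)(\Gamma(\alpha+1))^2},$$ where $c_2=\sum_{j=1}^kj^2\lambda_j$.
   Context: Generalized counting process (GCP): for $k\ge1$ and $\lambda_1,\dots,\lambda_k>0$, it is the non-negative integer valued Lévy process $\{M(t)\}_{t\ge0}$, $M(0)=0$, with $\Pr\{M(t+h)=n+j\mid M(t)=n\}=1-\Lambda h+o(h)$ for $j=0$, $=\lambda_jh+o(h)$ for $1\le j\le k$, $=o(h)$ for $j\ge k+1$, where $\Lambda=\sum_{j=1}^k\lambda_j$. Equivalently $\mathbb{E}(u^{M(t)})=\exp(-t\sum_{j=1}^k\lambda_j(1-u^j))$ for $|u|\le1$. *)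

(* Defs.v *)
From HB Require Import structures.
From mathcomp Require Import all_boot all_order all_algebra.
From mathcomp Require Import all_classical all_reals all_analysis.
Set Implicit Arguments.
Unset Strict Implicit.
Unset Printing Implicit Defensive.
Import Order.TTheory GRing.Theory Num.Theory.
Import numFieldNormedType.Exports.
Local Open Scope classical_set_scope.
Local Open Scope ring_scope.

Definition Gamma (R : realType) (a : R) : R :=
  \int[lebesgue_measure]_(x in `]0, +oo[) (x `^ (a - 1) * expR (- x)).

(* Left-sided Riemann-Liouville integral of order a, based at 0. *)
Definition RL_integral (R : realType) (a : R) (f : R -> R) (t : R) : R :=
  (Gamma a)^-1 *
  \int[lebesgue_measure]_(s in `[0, t]) ((t - s) `^ (a - 1) * f s).

(* Product rule for the whole family suffices: a subfamily is obtained by taking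
   [B i = setT] for the other indices. *)
Definition mutually_independent (d : measure_display) (T : measurableType d)
    (R : realType) (P : probability T R) (n : nat) (X : 'I_n -> T -> R) : Prop :=
  forall B : 'I_n -> set R, (forall i, measurable (B i)) ->
    P [set w | forall i, B i (X i w)] = (\prod_(i < n) P (X i @^-1` B i))%E.

(* Elementary conditional probability, meaningful only when [P B != 0]. *)
Definition cond_prob (d : measure_display) (T : measurableType d)
    (R : realType) (P : probability T R) (A B : set T) : R :=
  fine (P (A `&` B)) / fine (P B).

Definition incr (T : Type) (R : realType) (M : R -> T -> R) (s t : R) : T -> R :=
  fun w => M t w - M s w.

(* Processes are indexed by all of [R]; only times [t >= 0] are constrained. *)
Record is_levy_process (d : measure_display) (T : measurableType d)
    (R : realType) (P : probability T R) (M : R -> {RV P >-> R}) : Prop := {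
  levy_start : {ae P, forall w, M 0 w = 0};
  levy_independent_increments : forall (n : nat) (t : nat -> R), 0 <= t 0%N ->
    (forall i, (i < n)%N -> t i < t i.+1) ->
    mutually_independent P (fun i : 'I_n => incr M (t i) (t i.+1));
  levy_stationary_increments : forall s t : R, 0 <= s -> 0 <= t ->
    forall B : set R, measurable B ->
    P (incr M s (s + t) @^-1` B) = P (incr M 0 t @^-1` B);
  levy_stochastically_continuous : forall t eps : R, 0 <= t -> 0 < eps ->
    (fun s => P [set w | eps < `|incr M t s w|])
      @ within `[0, +oo[ (nbhs t) --> 0%E;
  levy_cadlag : {ae P, forall w,
    (forall t : R, 0 <= t -> (M ^~ w) s @[s --> t^'+] --> M t w) /\
    (forall t : R, 0 < t -> cvg ((M ^~ w) s @[s --> t^'-]))} }.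

(* Rates are [l 1, ..., l k]; the values of [l] elsewhere are irrelevant. *)
Record is_gcp (d : measure_display) (T : measurableType d)
    (R : realType) (P : probability T R) (k : nat) (l : nat -> R)
    (M : R -> {RV P >-> R}) : Prop := {
  gcp_levy : is_levy_process M;
  gcp_nat_valued : forall (t : R) w, 0 <= t -> M t w \is a Num.nat;
  gcp_transition : forall (t : R) (n j : nat), 0 <= t ->
    P (M t @^-1` [set n%:R]) != 0%E ->
    (fun h : R =>
       cond_prob P (M (t + h) @^-1` [set (n + j)%:R]) (M t @^-1` [set n%:R])
       - (if j == 0%N then 1 - (\sum_(1 <= i < k.+1) l i) * h
          else if (j <= k)%N then l j * h
          else 0))
      =o_ (0^'+) (fun h : R => h) }.

(* Main.v *)
(** Write [c1 = sum_j j l_j] and [c2 = sum_j j^2 l_j].  Independence and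
    stationarity of the increments make [G_u t = E (u ^ M t)] multiplicative in
    [t]; the transition rates give its derivative at [0], so that
    [G_u t = exp (t sum_j l_j (u^j - 1))].  As [u] increases to [1], monotone
    convergence of [((1 - u^M) / (1 - u))^i], [i = 1, 2], then yields the first
    two moments of [M t], and independence of increments yields
    [E (M s * M r) = c1^2 s r + c2 min s r].
    The paths are right-continuous, hence [M] is jointly measurable off a null
    set and Tonelli's theorem applies: with [k s = (t - s)^(alpha - 1)], the
    variance of [int k M] is
    [c2 int int k s k r min s r = c2 int_0^t (int_x^t k)^2 dx],
    which is elementary. *)
Require Import Defs.
From HB Require Import structures.
From mathcomp Require Import all_boot all_order all_algebra.
From mathcomp Require Import all_classical all_reals all_analysis.
From mathcomp Require Import measurable_realfun ring lra.
Import Order.TTheory GRing.Theory Num.Theory.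
Import numFieldNormedType.Exports.
Local Open Scope classical_set_scope.
Local Open Scope ring_scope.
Set Implicit Arguments.
Unset Strict Implicit.
Unset Printing Implicit Defensive.

(** * Real integrals *)

(** Three obstacles shape the argument. [P] is not assumed complete and the paths are regular only
    almost surely, so the fractional integral is not known to be measurable in [w]; its variance is
    the integral of a possibly nonmeasurable nonnegative function, evaluated by comparison with a
    measurable version off a null set. Next, the [o(h)] bounds for the states [j > k] are not
    uniform in [j], so [P (M h > k)] cannot be estimated by summing them: it is taken as one minus
    the probabilities of the states up to [k], and is [o(h)] because the rates, with minus their sum
    at state 0, add up to zero. Last, for [alpha < 1] the kernel blows up at [s = t], whence the
    integrals of powers over open intervals. Integrals are of nonnegative functions with values in
    [\bar R]. Finiteness is then read off from identities instead of being established beforehand,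
    and a subtraction is replaced by adding the negative term to both sides. *)

Section ge0_FTC_oo.
Context {R : realType}.
Notation mu := lebesgue_measure.
Implicit Types (f F : R -> R) (a b : R).

Lemma cvg_div_natS (c : R) (m : nat) : c / (n + m.+1)%:R @[n --> \oo] --> (0 : R).
Proof.
rewrite -(mulr0 c); apply: cvgM; first exact: cvg_cst.
rewrite (_ : (fun n => _) = (fun n => harmonic (n + m)%N)); last first.
  by apply/funext => n /=; rewrite addnS.
by rewrite (cvg_shiftn m (@harmonic R)); exact: cvg_harmonic.
Qed.

(** Here [f] may be unbounded at both ends, as powers with negative exponent are. The
    closed-interval theorem is applied on an increasing exhaustion of []a, b[]; the integrals
    converge by monotonicity and the values of [F] by one-sided continuity. *)
Lemma ge0_continuous_FTC2_oo f F a b : a < b ->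
  {in `]a, b[, forall x, 0 <= f x} ->
  {in `]a, b[, forall x, {for x, continuous f}} ->
  derivable_oo_LRcontinuous F a b -> {in `]a, b[, F^`()%classic =1 f} ->
  (\int[mu]_(x in `]a, b[) (f x)%:E = (F b - F a)%:E)%E.
Proof.
move=> ab f0 cf dF F'f.
(* The shift by 3 gives [e n <= (b - a) / 3], so that [a + e n < b - e n] already for [n = 0]. *)
pose e n : R := (b - a) / (n + 3)%:R.
have n3 n : 0 < (n + 3)%:R :> R by rewrite ltr0n addn3.
have e0 n : 0 < e n by rewrite divr_gt0// subr_gt0.
have ba3 n : e n <= (b - a) / 3.
  by rewrite ler_pM2l ?subr_gt0// lef_pV2 ?posrE// ler_nat leq_addl.
have en : e n @[n --> \oo] --> (0 : R) by exact: cvg_div_natS.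
pose A n := `[a + e n, b - e n]%classic.
have subA n : [set` `[a + e n, b - e n]] `<=` [set` `]a, b[].
  by apply: subset_itv; rewrite bnd_simp ?ltrDl ?ltrBlDr ?ltrDl.
have sub1 n : {subset `[a + e n, b - e n] <= `]a, b[}.
  by move=> x; exact: (@subA n x).
have cA n : {within [set` `[a + e n, b - e n]], continuous f}.
  apply: continuous_in_subspaceT => x; rewrite inE /= => xA.
  by apply: cf; exact: sub1 xA.
have aeb n : a + e n < b - e n by have := ba3 n; have := e0 n; lra.
have intA n : (\int[mu]_(x in A n) (f x)%:E = (F (b - e n) - F (a + e n))%:E)%E.
  rewrite EFinB; apply: continuous_FTC2 => //.
  - by apply: derivable_oo_continuousW dF => // x /subA; apply: subset_itv_oo_cc.
  - by move=> x /subset_itv_oo_cc /sub1; exact: F'f.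
have ndA : nondecreasing_seq A.
  move=> m n mn; rewrite subsetEset.
  have emn : e n <= e m.
    by rewrite ler_pM2l ?subr_gt0// lef_pV2 ?posrE// ler_nat leq_add2r.
  by apply: subset_itv; rewrite bnd_simp ?lerD2l ?lerN2.
have UA : \bigcup_n A n = `]a, b[%classic.
  apply/seteqP; split=> [x [n _] /subA//|x /=]; rewrite in_itv/= => /andP[ax xb].
  have m0 : 0 < Num.min (x - a) (b - x) by rewrite lt_min !subr_gt0 ax.
  near \oo => n; exists n => //; rewrite /A /= in_itv/=.
  have : e n < Num.min (x - a) (b - x).
    by near: n; exact: (cvgr_lt 0 en).
  by rewrite lt_min => /andP[]; lra.
have cv1 : (\int[mu]_(x in A n) (f x)%:E)%E @[n --> \oo] -->
    (\int[mu]_(x in `]a, b[) (f x)%:E)%E.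
  rewrite -UA; apply: ge0_nondecreasing_set_cvg_integral => //.
  - by move=> i; exact: measurable_itv.
  - by move=> i; apply/measurable_EFinP; apply: subspace_continuous_measurable_fun;
      [exact: measurable_itv|exact: cA].
  - by move=> i x /subA xab; rewrite lee_fin f0.
move: cv1; rewrite (funext intA) => cv1.
apply: (cvg_unique _ cv1) => //.
apply: cvg_EFin; first exact: nearW.
rewrite (_ : fine \o _ = (fun n => F (b - e n) - F (a + e n)))//.
case: dF => _ Fa Fb; apply: cvgB.
- apply: ((cvg_at_leftP _ _ _).1 Fb); split; first by move=> n; rewrite ltrBlDr ltrDl.
  by rewrite -[X in _ --> X]subr0; apply: cvgB => //; exact: cvg_cst.
- apply: ((cvg_at_rightP _ _ _).1 Fa); split; first by move=> n; rewrite ltrDl.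
  by rewrite -[X in _ --> X]addr0; apply: cvgD => //; exact: cvg_cst.
Unshelve. all: by end_near. Qed.

End ge0_FTC_oo.

Section powR_integrals.
Context {R : realType}.
Notation mu := lebesgue_measure.

Lemma continuous_powR (p x : R) : 0 < x -> {for x, continuous (@powR R ^~ p)}.
Proof.
move=> x0; apply: differentiable_continuous; apply/derivable1_diffP.
by apply: derivable_powR; rewrite in_itv/= x0.
Qed.

Lemma integral_powR_oo (p x : R) : 0 < p -> 0 <= x ->
  (\int[mu]_(y in `]0%R, x[) (y `^ (p - 1))%:E = (x `^ p / p)%:E)%E.
Proof.
move=> p0; rewrite le_eqVlt => /predU1P[<-|x0].
  by rewrite set_itvoo0 integral_set0 powR0 ?gt_eqF// mul0r.
rewrite (@ge0_continuous_FTC2_oo _ _ (fun y => p^-1 * y `^ p))//.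
- by rewrite (@powR0 _ p) ?gt_eqF// mulr0 subr0 mulrC.
- by move=> y _; exact: powR_ge0.
- by move=> y; rewrite in_itv/= => /andP[y0 _]; exact: continuous_powR.
- split.
  + move=> y; rewrite in_itv/= => /andP[y0 _].
    by apply: derivableM => //; apply: derivable_powR; rewrite in_itv/= y0.
  + rewrite powR0 ?gt_eqF//; apply: cvgM; first exact: cvg_cst.
    exact: powR_cvg0.
  + apply: cvg_at_left_filter; apply: cvgM; first exact: cvg_cst.
    exact: continuous_powR.
- move=> y; rewrite in_itv/= => /andP[y0 _]; rewrite derive1E.
  have := is_derive1_powR p y0 => d; rewrite derive_val.
  by rewrite /GRing.scale/= mulKf ?gt_eqF.
Qed.

Lemma integral_powR_subr_oo (p x t : R) : 0 < p -> x <= t ->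
  (\int[mu]_(s in `]x, t[) ((t - s) `^ (p - 1))%:E = ((t - x) `^ p / p)%:E)%E.
Proof.
move=> p0; rewrite le_eqVlt => /predU1P[<-|xt].
  by rewrite set_itvoo0 integral_set0 subrr powR0 ?gt_eqF// mul0r.
have cB (y : R) : {for y, continuous (fun s => t - s)}.
  by apply: cvgB; [exact: cvg_cst|exact: cvg_id].
have cP (q y : R) : y < t -> {for y, continuous (fun s => (t - s) `^ q)}.
  move=> yt; have ty : 0 < t - y by rewrite subr_gt0.
  exact: (cvg_comp _ _ (cB y) (@continuous_powR q _ ty)).
have dP (y : R) : y < t ->
    is_derive y 1 (fun s => - p^-1 * (t - s) `^ p) ((t - y) `^ (p - 1)).
  move=> yt; have ty : 0 < t - y by rewrite subr_gt0.
  have dB : is_derive y 1 (fun s : R => t - s) (-1).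
    by rewrite -[X in is_derive _ _ _ X]add0r; exact: is_deriveB.
  have dc := @is_derive1_comp R (@powR R ^~ p) (fun s => t - s) y _ _ (is_derive1_powR p ty) dB.
  have := is_deriveZ (- p^-1) dc.
  rewrite (_ : - p^-1 *: _ = (t - y) `^ (p - 1)) ?/GRing.scale//=.
  by field; rewrite gt_eqF.
rewrite (@ge0_continuous_FTC2_oo _ _ (fun s => - p^-1 * (t - s) `^ p))//.
- rewrite subrr (@powR0 _ p) ?gt_eqF// mulr0 add0r mulNr opprK mulrC//.
- by move=> y _; exact: powR_ge0.
- by move=> y; rewrite in_itv/= => /andP[_ yt]; exact: cP.
- split.
  + by move=> y; rewrite in_itv/= => /andP[_ yt]; have [] := dP _ yt.
  + apply: cvg_at_right_filter; apply: cvgM; first exact: cvg_cst.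
    exact: cP.
  + rewrite subrr powR0 ?gt_eqF//; apply: cvgM; first exact: cvg_cst.
    (* [powR_cvg0] is a limit from the right at 0: along a sequence [u n < t] tending to [t], the
       differences [t - u n] tend to 0 from the right. *)
    apply/cvg_at_leftP => u [ut cu].
    apply: ((cvg_at_rightP (@powR R ^~ p) 0 0).1 (powR_cvg0 p0)); split.
      by move=> n; rewrite subr_gt0.
    by rewrite -(subrr t); apply: cvgB => //; exact: cvg_cst.
- move=> y; rewrite in_itv/= => /andP[_ yt]; rewrite derive1E.
  by have d := dP _ yt; rewrite derive_val.
Qed.

End powR_integrals.

(** * The recurrence of the Gamma function *)

Section kernels.
Context {R : realType}.
Notation mu := (@lebesgue_measure R).

(** Tonelli's theorem is used on full product spaces. Moving the domain into the integrand lets the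
    bounds of an inner integral depend on the outer variable. *)
Lemma integral_ifT (b : R -> bool) (f : R -> \bar R) (D : set R) :
  (forall x, D x <-> b x) ->
  (\int[mu]_(x in D) f x = \int[mu]_x (if b x then f x else 0))%E.
Proof.
move=> bD; rewrite integral_mkcond; apply: eq_integral => x _.
rewrite patchE; congr (if _ then _ else _); apply/idP/idP => [/set_mem/bD//|/bD].
exact: mem_set.
Qed.

Lemma integral_expRN_oy (y : R) :
  (\int[mu]_(x in `]y, +oo[) (expR (- x))%:E = (expR (- y))%:E)%E.
Proof.
have cexp : continuous (fun x : R => expR (- x)).
  by move=> x; apply: continuous_comp; [exact: opp_continuous|exact: continuous_expR].
have dexp (x : R) : is_derive x 1 (fun x => - expR (- x)) (expR (- x)).
  have dN : is_derive x 1 (fun s : R => - s) (-1) by exact: is_deriveN.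
  have dc := is_deriveN (@is_derive1_comp R expR (fun s => - s) x _ _ (is_derive_expR _) dN).
  by rewrite mulrN1 opprK in dc.
rewrite integral_itv_obnd_cbnd; last first.
  apply/measurable_EFinP; apply: measurable_funTS.
  exact: continuous_measurable_fun.
rewrite (@ge0_continuous_FTC2y _ _ (fun x => - expR (- x)) _ 0).
- by rewrite EFinN oppeK add0e.
- by move=> x _; exact: expR_ge0.
- exact: continuous_subspaceT.
- by rewrite -oppr0; apply: cvgN; exact: cvgr_expR.
- by move=> x _; have [] := dexp x.
- apply: cvg_at_right_filter; apply: cvgN; exact: cexp.
- by move=> x _; rewrite derive1E; have := dexp x => ?; rewrite derive_val.
Qed.

(* Tonelli gives the identity in [\bar R], so convergence of the integral is
   not needed: [fine] sends [+oo] to [0] on both sides. *)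
Lemma Gamma_recurrence (a : R) : 0 < a -> Gamma (a + 1) = a * Gamma a.
Proof.
move=> a0; rewrite /Gamma /Rintegral addrK.
(* The function [a y^(a - 1) e^(-x)] on [0 < y < x]: integrating in [y] first gives [x^a e^(-x)],
   integrating in [x] first gives [a y^(a - 1) e^(-y)]. *)
pose f (p : R * R) : \bar R := (if 0 < p.2 then
  if p.2 < p.1 then a * p.2 `^ (a - 1) * expR (- p.1) else 0 else 0)%:E.
have mf : measurable_fun setT f.
  apply/measurable_EFinP; apply: measurable_fun_ifT => //.
    by apply: measurable_fun_ltr => //; exact: measurable_snd.
  apply: measurable_fun_ifT => //.
    by apply: measurable_fun_ltr.
  apply: measurable_funM => //.
    apply: measurable_funM => //.
    apply: (measurableT_comp (measurable_powR (a - 1))); exact: measurable_snd.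
  apply: measurableT_comp => //.
  by apply: measurableT_comp => //; exact: measurable_fst.
have f0 p : (0 <= f p)%E.
  rewrite lee_fin; case: ifP => // _; case: ifP => // _.
  by rewrite !mulr_ge0 ?powR_ge0 ?expR_ge0// ltW.
have := @fubini_tonelli _ _ _ _ _ mu mu f mf f0.
rewrite (_ : (\int[mu]_x \int[mu]_y f (x, y))%E =
  (\int[mu]_(x in `]0%R, +oo[) (x `^ a * expR (- x))%:E)%E); last first.
  rewrite [RHS](integral_ifT (b := fun x : R => 0 < x)); last first.
    by move=> x; rewrite /= in_itv/= andbT.
  apply: eq_integral => x _; case: ifPn => x0; last first.
    rewrite integral0_eq// => y _; rewrite /f/=; case: ifP => // y0.
    by case: ifP => // yx; move: x0; rewrite (lt_trans y0 yx).
  transitivity (\int[mu]_(y in `]0%R, x[) ((a * expR (- x))%:E * (y `^ (a - 1))%:E))%E.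
    rewrite [RHS](integral_ifT (b := fun y : R => (0 < y) && (y < x))); last first.
      by move=> y; rewrite /= in_itv/=.
    apply: eq_integral => y _; rewrite /f/=; case: ifP => //= _.
    by case: ifP => // _; rewrite -EFinM; congr EFin; ring.
  rewrite ge0_integralZl_EFin//.
  - rewrite integral_powR_oo ?ltW// -EFinM; congr EFin.
    by field; rewrite gt_eqF.
  - by move=> y _; rewrite lee_fin powR_ge0.
  - by apply/measurable_EFinP; apply: measurable_funTS; exact: measurable_powR.
  - by rewrite mulr_ge0 ?expR_ge0// ltW.
rewrite (_ : (\int[mu]_y \int[mu]_x f (x, y))%E =
  (a%:E * \int[mu]_(x in `]0%R, +oo[) (x `^ (a - 1) * expR (- x))%:E)%E); last first.
  rewrite -ge0_integralZl_EFin//; last 3 first.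
  - by move=> y _; rewrite lee_fin mulr_ge0 ?powR_ge0 ?expR_ge0.
  - apply/measurable_EFinP; apply: measurable_funTS; apply: measurable_funM => //.
    by apply: measurableT_comp.
  - exact: ltW.
  rewrite [RHS](integral_ifT (b := fun x : R => 0 < x)); last first.
    by move=> x; rewrite /= in_itv/= andbT.
  apply: eq_integral => y _; case: ifPn => y0; last first.
    by rewrite integral0_eq// => x _; rewrite /f/= (negbTE y0).
  transitivity (\int[mu]_(x in `]y, +oo[) ((a * y `^ (a - 1))%:E * (expR (- x))%:E))%E.
    rewrite [RHS](integral_ifT (b := fun x : R => y < x)); last first.
      by move=> x; rewrite /= in_itv/= andbT.
    by apply: eq_integral => x _; rewrite /f/= y0; case: ifP.
  rewrite ge0_integralZl_EFin//.
  - by rewrite integral_expRN_oy -!EFinM; congr EFin; ring.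
  - apply/measurable_EFinP; apply: measurable_funTS.
    by apply: measurableT_comp.
  - by rewrite mulr_ge0 ?powR_ge0// ltW.
move=> ->; set I := (\int[_]_(_ in _) _)%E.
have : (0 <= I)%E.
  by apply: integral_ge0 => x _; rewrite lee_fin mulr_ge0 ?powR_ge0 ?expR_ge0.
case: I => [r| |]//= _.
by rewrite mulry gtr0_sg// mul1e mulr0.
Qed.

End kernels.

(** * The quadratic form of the kernel [min s r] *)

Section min_kernel.
Context {R : realType}.
Notation mu := (@lebesgue_measure R).
Variable k : R -> R.
Hypotheses (mk : measurable_fun setT k) (k0 : forall s, 0 <= k s).

Let K (x : R) : \bar R := (\int[mu]_(s in `]x, +oo[) (k s)%:E)%E.

Let KE x : K x = (\int[mu]_s (if (x < s)%R then (k s)%:E else 0))%E.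
Proof. by apply: integral_ifT => s; rewrite /= in_itv/= andbT. Qed.

Let mK : measurable_fun setT K.
Proof.
rewrite (funext KE).
apply: (@measurable_fun_fubini_tonelli_F _ _ _ _ R mu
  (fun p : R * R => if p.1 < p.2 then (k p.2)%:E else 0%E)).
- apply: measurable_fun_ifT => //; first exact: measurable_fun_ltr.
  by apply/measurable_EFinP; apply: measurableT_comp.
- by move=> p; case: ifP => // _; rewrite lee_fin.
Qed.

Let K0 x : (0 <= K x)%E.
Proof. by apply: integral_ge0 => s _; rewrite lee_fin. Qed.

(** For [s, r >= 0], [min s r] is the length of the set of [x] with [0 < x < s] and [x < r];
    exchanging [r] and [x] leaves the tail integral [K x]. For [r < 0] the minimum is negative, and
    the vanishing of [k] there removes it. *)
Let integral_kM_min (s : R) : (forall r, r < 0 -> k r = 0) -> 0 <= s ->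
  (\int[mu]_r (k r * Num.min s r)%:E =
   \int[mu]_x (if (0 < x)%R && (x < s)%R then K x else 0))%E.
Proof.
move=> kneg s0.
pose f (p : R * R) : \bar R :=
  (if (0 < p.2) && (p.2 < s) && (p.2 < p.1) then k p.1 else 0)%:E.
have mf : measurable_fun setT f.
  apply/measurable_EFinP; apply: measurable_fun_ifT => //.
    by apply: measurable_and; [apply: measurable_and|]; exact: measurable_fun_ltr.
  exact: measurableT_comp.
have f0 p : (0 <= f p)%E by rewrite lee_fin; case: ifP.
have := @fubini_tonelli _ _ _ _ _ mu mu f mf f0.
congr (_ = _); apply: eq_integral => x _.
- have [x0|x0] := ltP x 0.
    rewrite kneg// mul0r integral0_eq// => y _; rewrite /f/= kneg//.
    by rewrite if_same.
  transitivity (\int[mu]_(y in `]0%R, (Num.min s x)[) (cst (k x)%:E y))%E.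
    rewrite (integral_ifT (b := fun y : R => (0 < y) && (y < Num.min s x))).
      by apply: eq_integral => y _; rewrite /f/= lt_min andbA; case: ifP.
    by move=> y; rewrite /= in_itv.
  rewrite integral_cst//= lebesgue_measure_itv/= lte_fin lt_min.
  have [s00|s00] := ltP 0 s; have [x00|x00] := ltP 0 x => //=.
  + by rewrite -EFinB subr0 -EFinM.
  + by have -> : x = 0; [lra|rewrite (min_idPr _)// mulr0 mule0].
  + by have -> : s = 0; [lra|rewrite (min_idPl _)// mulr0 mule0].
  + by have -> : s = 0; [lra|rewrite (min_idPl _)// mulr0 mule0].
- rewrite KE; case: ifPn => x0; last first.
    by rewrite integral0_eq// => r _; rewrite /f/= (negbTE x0).
  by apply: eq_integral => r _; rewrite /f/= x0/=; case: ifP.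
Qed.

(** After the inner integral has been rewritten with [K], a second exchange, of [s] and [x], turns
    the remaining factor [k s] on [s > x] into another [K x]. *)
Lemma integral_min_kernel : (forall r, r < 0 -> k r = 0) ->
  (\int[mu]_s ((k s)%:E * \int[mu]_r (k r * Num.min s r)%:E) =
   \int[mu]_(x in `]0%R, +oo[) (\int[mu]_(s in `]x, +oo[) (k s)%:E *
                              \int[mu]_(s in `]x, +oo[) (k s)%:E))%E.
Proof.
move=> kneg.
pose g (p : R * R) : \bar R :=
  (if (0 < p.2)%R && (p.2 < p.1)%R then (k p.1)%:E * K p.2 else 0)%E.
have mg : measurable_fun setT g.
  apply: measurable_fun_ifT => //.
    by apply: measurable_and; exact: measurable_fun_ltr.
  by apply: emeasurable_funM; [apply/measurable_EFinP|]; exact: measurableT_comp.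
have g0 p : (0 <= g p)%E by rewrite /g; case: ifP => // _; rewrite mule_ge0 ?lee_fin.
transitivity (\int[mu]_s \int[mu]_x g (s, x))%E.
  apply: eq_integral => s _; have [s0|s0] := ltP s 0.
    rewrite kneg// mul0e integral0_eq// => x _; rewrite /g/= kneg// mul0e.
    by rewrite if_same.
  rewrite integral_kM_min// -ge0_integralZl//.
  - by apply: eq_integral => x _; rewrite /g/=; case: ifP => // _; rewrite mule0.
  - apply: measurable_fun_ifT => //.
    by apply: measurable_and; exact: measurable_fun_ltr.
  - by move=> x _; case: ifP.
  - by rewrite lee_fin.
rewrite (@fubini_tonelli _ _ _ _ _ mu mu g mg g0).
rewrite [RHS](integral_ifT (b := fun x : R => 0 < x)); last first.
  by move=> x; rewrite /= in_itv/= andbT.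
apply: eq_integral => x _; case: ifPn => x0; last first.
  by rewrite integral0_eq// => s _; rewrite /g/= (negbTE x0).
rewrite -/(K x) [X in (_ = X * _)%E]KE -ge0_integralZr//.
- by apply: eq_integral => s _; rewrite /g/= x0/=; case: ifP => // _; rewrite mul0e.
- apply: measurable_fun_ifT => //; first exact: measurable_fun_ltr.
  exact/measurable_EFinP.
- by move=> s _; case: ifP => // _; rewrite lee_fin.
Qed.

End min_kernel.

Section RL_kernel.
Context {R : realType}.
Notation mu := (@lebesgue_measure R).

(** Extended by zero to the whole line, so that Tonelli applies without domains and negative times,
    where the process is unconstrained, carry no weight. At [s = t] it takes the conventional value
    of a power of 0, on a single point. *)
Definition RL_kernel (a t s : R) : R :=
  if (0 <= s) && (s <= t) then (t - s) `^ (a - 1) else 0.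

Lemma RL_kernel_ge0 a t s : 0 <= RL_kernel a t s.
Proof. by rewrite /RL_kernel; case: ifP => // _; exact: powR_ge0. Qed.

Lemma measurable_RL_kernel a t : measurable_fun setT (RL_kernel a t).
Proof.
apply: measurable_fun_ifT => //.
  by apply: measurable_and; exact: measurable_fun_ler.
apply: (measurableT_comp (measurable_powR (a - 1))).
exact: measurable_funB.
Qed.

Lemma integral_RL_kernel a t x : 0 < a -> 0 <= x -> x <= t ->
  (\int[mu]_(s in `]x, +oo[) (RL_kernel a t s)%:E = ((t - x) `^ a / a)%:E)%E.
Proof.
move=> a0 x0 xt; rewrite -integral_powR_subr_oo//.
rewrite -(@integral_itv_bndoo _ x t _ false false); last first.
  apply/measurable_EFinP; apply: measurable_funTS.
  apply: (measurableT_comp (measurable_powR (a - 1))).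
  exact: measurable_funB.
rewrite (integral_ifT (b := fun s : R => x < s)); last first.
  by move=> s; rewrite /= in_itv/= andbT.
rewrite [RHS](integral_ifT (b := fun s : R => (x < s) && (s <= t))); last first.
  by move=> s; rewrite /= in_itv/=.
apply: eq_integral => s _; case: ifP => //= xs.
by rewrite /RL_kernel (le_trans x0 (ltW xs))/=; case: ifP.
Qed.

Lemma integral_RL_kernel_min a t : 0 < a -> 0 <= t ->
  (\int[mu]_s ((RL_kernel a t s)%:E *
     \int[mu]_r (RL_kernel a t r * Num.min s r)%:E) =
   (t `^ (2 * a + 1) / (a ^+ 2 * (2 * a + 1)))%:E)%E.
Proof.
move=> a0 t0; rewrite integral_min_kernel//; last 3 first.
- exact: measurable_RL_kernel.
- exact: RL_kernel_ge0.
- by move=> r r0; rewrite /RL_kernel leNgt r0.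
(* The tail of the kernel beyond [x] is [(t - x)^a / a], with square [(t - x)^(2a) / a^2]. The
   exponent is displayed as [p - 1] with [p = 2 * a + 1], the form of [integral_powR_subr_oo]. *)
transitivity (\int[mu]_(x in `]0%R, t[)
    (((a ^+ 2)^-1)%:E * ((t - x) `^ (2 * a + 1 - 1))%:E))%E.
  rewrite -(@integral_itv_bndoo _ 0 t _ false false); last first.
    apply: emeasurable_funM => //; apply/measurable_EFinP; apply: measurable_funTS.
    apply: (measurableT_comp (measurable_powR (2 * a + 1 - 1))).
    exact: measurable_funB.
  rewrite (integral_ifT (b := fun x : R => 0 < x)); last first.
    by move=> x; rewrite /= in_itv/= andbT.
  rewrite [RHS](integral_ifT (b := fun x : R => (0 < x) && (x <= t))); last first.
    by move=> x; rewrite /= in_itv/=.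
  apply: eq_integral => x _; case: ifP => //= x0; case: ifPn => xt.
    rewrite integral_RL_kernel// ?(ltW x0)// -!EFinM; congr EFin.
    rewrite addrK mulrC (mulrC 2) powRrM powR_mulrn ?powR_ge0//.
    by field; rewrite gt_eqF.
  rewrite [X in (X * _)%E]integral0_eq ?mul0e// => s; rewrite /= in_itv/= andbT => xs.
  rewrite /RL_kernel [s <= t]leNgt (lt_trans _ xs) ?andbF//.
  by rewrite ltNge.
rewrite ge0_integralZl_EFin//.
- rewrite integral_powR_subr_oo//; last by lra.
  by rewrite subr0 -EFinM; congr EFin; field; apply/andP; split; lra.
- by move=> x _; rewrite lee_fin powR_ge0.
- apply/measurable_EFinP; apply: measurable_funTS.
  apply: (measurableT_comp (measurable_powR (2 * a + 1 - 1))).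
  exact: measurable_funB.
- by rewrite invr_ge0 sqr_ge0.
Qed.

End RL_kernel.

(** * Integration against a probability *)

Section nonmeasurable_null.
Context d (T : measurableType d) (R : realType).
Variable mu : {measure set T -> \bar R}.

Import HBNNSimple.

(* Neither function is assumed measurable: the integral is a supremum over the
   simple functions below, and such a function can be cut off on [N]. *)
Lemma ge0_eq_integral_off_null (N : set T) (f g : T -> \bar R) :
  measurable N -> mu N = 0%E -> (forall x, 0 <= f x)%E -> (forall x, 0 <= g x)%E ->
  (forall x, ~ N x -> f x = g x) -> (\int[mu]_x f x = \int[mu]_x g x)%E.
Proof.
move=> mN N0.
suff le_fg (u v : T -> \bar R) : (forall x, 0 <= u x)%E -> (forall x, 0 <= v x)%E ->
    (forall x, ~ N x -> u x = v x) -> (\int[mu]_x u x <= \int[mu]_x v x)%E.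
  move=> f0 g0 fg; apply/eqP; rewrite eq_le; apply/andP; split; apply: le_fg => //.
  by move=> x Nx; rewrite fg.
move=> u0 v0 uv; rewrite [leLHS]ge0_integralTE// [leRHS]ge0_integralTE//.
apply: ge_ereal_sup => _ [h hu <-].
have mCN : measurable (~` N) by exact: measurableC.
apply: le_ereal_sup_tmp; exists (sintegral mu (proj_nnsfun h mCN)).
  exists (proj_nnsfun h mCN) => //= x; rewrite mindicE.
  have [|] := boolP (x \in ~` N); rewrite ?inE => Nx.
    by rewrite mulr1 -uv.
  by rewrite mulr0.
rewrite -!integralT_nnsfun.
rewrite (ge0_negligible_integral mN)//; last 2 first.
- exact/measurable_EFinP.
- by move=> x _; rewrite lee_fin.
rewrite setTD integral_mkcond le_eqVlt; apply/orP; left; apply/eqP.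
apply: eq_integral => x _; rewrite patchE /= mindicE.
by case: ifPn => _; rewrite ?mulr1 ?mulr0.
Qed.

End nonmeasurable_null.

Section laws.
Context d (T : measurableType d) (R : realType) (P : probability T R).

Lemma ge0_integral_comp_eq_law (X Y : T -> R) (f : R -> \bar R) :
  measurable_fun setT X -> measurable_fun setT Y ->
  (forall B, measurable B -> P (X @^-1` B) = P (Y @^-1` B)) ->
  measurable_fun setT f -> (forall x, 0 <= f x)%E ->
  (\int[P]_w f (X w) = \int[P]_w f (Y w))%E.
Proof.
move=> mX mY XY mf f0.
rewrite -[LHS](@ge0_integral_pushforward _ _ _ _ _ _ mX P setT f)//.
rewrite -[RHS](@ge0_integral_pushforward _ _ _ _ _ _ mY P setT f)//.
by apply: eq_measure_integral => A mA _; exact: XY.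
Qed.

(** Independence says that the law of [(X, Y)] agrees on rectangles with the product of the two
    laws; by uniqueness of the product measure they coincide, and Tonelli separates the
    variables. *)
Lemma ge0_integral_mul_indep (X Y : T -> R) (f g : R -> \bar R) :
  measurable_fun setT X -> measurable_fun setT Y ->
  (forall A B, measurable A -> measurable B ->
     P (X @^-1` A `&` Y @^-1` B) = (P (X @^-1` A) * P (Y @^-1` B))%E) ->
  measurable_fun setT f -> measurable_fun setT g ->
  (forall x, 0 <= f x)%E -> (forall x, 0 <= g x)%E ->
  (\int[P]_w (f (X w) * g (Y w)) = \int[P]_w f (X w) * \int[P]_w g (Y w))%E.
Proof.
move=> mX mY XY mf mg f0 g0.
have mXY : measurable_fun setT (fun w => (X w, Y w)) by exact: measurable_fun_pair.
pose XY' : {mfun T >-> (R * R)%type} := mfun_Sub (mem_set mXY).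
pose X' : {mfun T >-> R} := mfun_Sub (mem_set mX).
pose Y' : {mfun T >-> R} := mfun_Sub (mem_set mY).
pose h (p : R * R) := (f p.1 * g p.2)%E.
have mh : measurable_fun setT h.
  by apply: emeasurable_funM; exact: measurableT_comp.
have h0 p : (0 <= h p)%E by exact: mule_ge0.
rewrite -[LHS](@ge0_integral_pushforward _ _ _ _ _ _ mXY P setT h)//.
pose PX : probability R R := distribution P X'.
pose PY : probability R R := distribution P Y'.
transitivity (\int[(PX \x PY)%E]_p h p)%E.
  apply: eq_measure_integral => A mA _; apply/esym.
  exact: (@product_measure_unique _ _ _ _ _ PX PY (distribution P XY')).
rewrite (@fubini_tonelli1 _ _ _ _ _ PX PY h mh h0) /fubini_F /h/=.
transitivity (\int[PX]_x (f x * \int[P]_w g (Y w)))%E.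
  apply: eq_integral => x _; rewrite ge0_integralZl//.
  by rewrite (@ge0_integral_pushforward _ _ _ _ _ _ mY P setT g).
rewrite ge0_integralZr//; last exact: integral_ge0.
by rewrite (@ge0_integral_pushforward _ _ _ _ _ _ mX P setT f).
Qed.

End laws.

Section variance_off_null.
Context d (T : measurableType d) (R : realType) (P : probability T R).

(** Meant for [Y] the fractional integral and [Z] its measurable version before the factor
    [g = 1 / Gamma alpha]. [Z] may be infinite, but only on a null set since its integral is finite;
    this set is added to [N]. *)
Lemma variance_off_null (N : set T) (Z : T -> \bar R) (Y : T -> R) (g a b : R) :
  measurable N -> P N = 0%E -> measurable_fun setT Z -> (forall w, 0 <= Z w)%E ->
  0 <= g -> (forall w, 0 <= Y w) -> (forall w, ~ N w -> Y w = g * fine (Z w)) ->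
  (\int[P]_w Z w = a%:E)%E -> (\int[P]_w (Z w * Z w) = b%:E)%E ->
  'V_P[Y] = (g ^+ 2 * (b - a ^+ 2))%:E.
Proof.
move=> mN N0 mZ Z0 g0 Y0 YZ Za Zb.
have iZ : P.-integrable setT Z.
  apply/integrableP; split => //; under eq_integral do rewrite gee0_abs//.
  by rewrite Za ltry.
have [N2 [mN2 N20 subN2]] := integrable_ae measurableT iZ.
have fZ w : ~ N2 w -> Z w = (fine (Z w))%:E.
  move=> N2w; rewrite fineK//; apply: contrapT => Zw.
  by apply: N2w; apply: subN2 => /=; apply: contra_not Zw; exact.
pose N' := N `|` N2.
have mN' : measurable N' by exact: measurableU.
have N'0 : P N' = 0%E.
  by rewrite /N' measureU0.
have a0 : 0 <= a by rewrite -lee_fin -Za; exact: integral_ge0.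
have EY : ('E_P[Y] = (g * a)%:E)%E.
  rewrite unlock (@ge0_eq_integral_off_null _ _ _ _ _ _ (fun w => g%:E * Z w)%E mN' N'0).
  - by rewrite ge0_integralZl_EFin// Za.
  - by move=> w; rewrite lee_fin.
  - by move=> w; rewrite mule_ge0.
  - move=> w /not_orP[Nw N2w].
    by rewrite YZ// (fZ w N2w)/= EFinM.
set m := g * a in EY.
have m0 : 0 <= m by rewrite mulr_ge0.
pose q (w : T) : \bar R := ((g * fine (Z w) - m) ^+ 2)%:E.
have mq : measurable_fun setT q.
  apply/measurable_EFinP; apply: measurable_funX; apply: measurable_funB => //.
  by apply: measurable_funM => //; exact: measurableT_comp.
have q0 w : (0 <= q w)%E by rewrite lee_fin sqr_ge0.
have mZZ : measurable_fun setT (fun w => Z w * Z w)%E by exact: emeasurable_funM.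
have -> : 'V_P[Y] = (\int[P]_w q w)%E.
  rewrite /variance unlock EY unlock.
  apply: (@ge0_eq_integral_off_null _ _ _ _ _ _ q mN' N'0) => //.
  - by move=> w; rewrite lee_fin sqr_ge0.
  - by move=> w /not_orP[Nw N2w]; rewrite /q -YZ.
(* Integrated form of [(g Z - m)^2 + 2 m g Z = g^2 Z^2 + m^2]. With the cross term on the left every
   summand is nonnegative, and the identity forces the integral of [q] to be finite. *)
have : (\int[P]_w q w + (2 * m * g * a)%:E = (g ^+ 2 * b + m ^+ 2)%:E)%E.
  have c0 : 0 <= 2 * m * g by rewrite !mulr_ge0.
  have mgZ : measurable_fun setT (fun w => (2 * m * g)%:E * Z w)%E.
    exact: emeasurable_funM.
  rewrite EFinM -Za -ge0_integralZl_EFin// -ge0_integralD//; last first.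
    by move=> w _; rewrite mule_ge0// lee_fin.
  rewrite (@ge0_eq_integral_off_null _ _ _ _ _ _
    (fun w => (g ^+ 2)%:E * (Z w * Z w) + (m ^+ 2)%:E)%E mN' N'0).
  - rewrite ge0_integralD//; last 3 first.
    + by move=> w _; rewrite !mule_ge0// lee_fin sqr_ge0.
    + exact: emeasurable_funM.
    + by move=> w _; rewrite lee_fin sqr_ge0.
    rewrite ge0_integralZl_EFin ?sqr_ge0//; last by move=> w _; rewrite mule_ge0.
    by rewrite Zb integral_cst// [X in (_ + _ * X)%E](@probability_setT _ _ _ P) mule1.
  - by move=> w; rewrite adde_ge0// mule_ge0// lee_fin.
  - by move=> w; rewrite adde_ge0 ?mule_ge0 ?lee_fin ?sqr_ge0.
  - move=> w /not_orP[Nw N2w]; rewrite /q (fZ w N2w)/= -!EFinM -!EFinD.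
    by congr EFin; ring.
case: (\int[P]_w q w)%E => // x; rewrite -EFinD => -[xE]; congr EFin.
by rewrite /m in xE; lra.
Qed.

End variance_off_null.

(** * Joint measurability of right-continuous processes *)

Section right_continuous.
Context d (T : measurableType d) (R : realType).

(** [X] is the pointwise limit of processes constant in time on the cells of a grid of mesh
    [1 / (n + 1)], whose preimages are countable unions of measurable rectangles. *)
Lemma measurable_right_continuous (X : R -> T -> R) :
  (forall s, 0 <= s -> measurable_fun setT (X s)) ->
  (forall s w, 0 <= s -> (X ^~ w) r @[r --> s^'+] --> X s w) ->
  measurable_fun [set p : R * T | 0 <= p.1] (fun p => X p.1 p.2).
Proof.
move=> mX rcX.
(* The first grid point strictly above [s]: the right limit at [s] only concerns times [> s], so the
   successor matters even when [s] lies on the grid. *)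
pose s_ n (s : R) : R := (Num.truncn (n.+1%:R * s)).+1%:R / n.+1%:R.
have n0 n : 0 < n.+1%:R :> R by [].
apply: (@measurable_fun_cvg _ _ _ _ (fun n p => X (s_ n p.1) p.2)); last first.
  move=> [s w] /= s0; apply: ((cvg_at_rightP _ _ _).1 (rcX s w s0)).
  have H n : s < s_ n s <= s + n.+1%:R^-1.
    have /truncn_itv /andP[h1 h2] : 0 <= n.+1%:R * s by rewrite mulr_ge0.
    rewrite /s_ ltr_pdivlMr// mulrC h2/= ler_pdivrMr// mulrDl mulVf ?gt_eqF//.
    by rewrite -[leLHS]natr1 lerD2r (mulrC s).
  split; first by move=> n; have /andP[] := H n.
  apply: (@squeeze_cvgr _ _ _ _ (fun=> s) (fun n => s + n.+1%:R^-1)).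
  - by apply: nearW => n; have /andP[/ltW -> ->] := H n.
  - exact: cvg_cst.
  - by rewrite -[X in _ --> X]addr0; apply: cvgD; [exact: cvg_cst|exact: cvg_harmonic].
move=> n _ B mB.
rewrite (_ : _ `&` _ = \bigcup_i
  (`[i%:R / n.+1%:R, i.+1%:R / n.+1%:R[%classic `*` (X (i.+1%:R / n.+1%:R) @^-1` B))).
  apply: bigcupT_measurable => i; apply: measurableX => //.
  by rewrite -[_ @^-1` _]setTI; apply: mX.
apply/seteqP; split => [[s w] [/= s0 Bsw]|[s w] [i _ [/= + Bi]]].
- exists (Num.truncn (n.+1%:R * s)) => //; split => //=.
  have /truncn_itv /andP[h1 h2] : 0 <= n.+1%:R * s by rewrite mulr_ge0.
  by rewrite in_itv/= ler_pdivrMr// ltr_pdivlMr// !(mulrC s) h1.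
- rewrite in_itv/= ler_pdivrMr// ltr_pdivlMr// !(mulrC s) => /andP[h1 h2].
  have s0 : 0 <= s by rewrite -(pmulr_rge0 _ (n0 n)) (le_trans _ h1).
  split => //; rewrite /s_ (_ : Num.truncn _ = i)//.
  by apply: truncn_def; rewrite h1.
Qed.

End right_continuous.

(** * Moments of the generalized counting process *)

Lemma measurable_powR_exponent (R : realType) (u : R) : 0 < u ->
  measurable_fun setT (powR u).
Proof.
move=> u0; rewrite (_ : powR u = (fun x => expR (x * ln u))).
  by apply: measurableT_comp => //; exact: measurable_funM.
by apply/funext => x; rewrite /powR gt_eqF.
Qed.

(** * Moments from a probability generating function *)

Section pgf_moments.
Context d (T : measurableType d) (R : realType) (P : probability T R).

(** This is [(1 - u ^+ N) / (1 - u)] without the division, which makes its monotonicity in [u >= 0]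
    and its value [N] at [u = 1] visible. *)
Let geo (N : nat) (u : R) : R := \sum_(i < N) u ^+ i.

Let geoE N u : 1 - u ^+ N = (1 - u) * geo N u.
Proof. by rewrite /geo -opprB subrX1 -mulNr opprB. Qed.

Let cvgX (f : R^nat) (l : R) (n : nat) : f i @[i --> \oo] --> l ->
  f i ^+ n @[i --> \oo] --> l ^+ n.
Proof. by move=> fl; exact: (cvg_comp _ _ fl (@exprn_continuous R n l)). Qed.

Let cvg_geo N (u : R^nat) : u n @[n --> \oo] --> (1 : R) ->
  geo N (u n) @[n --> \oo] --> (N%:R : R).
Proof.
move=> u1; rewrite /geo.
have -> : (N%:R : R) = \sum_(i < N) 1 ^+ i.
  by under eq_bigr do rewrite expr1n; rewrite sumr_const card_ord.
by apply: cvg_big => [|i _]; [exact: add_continuous|exact: cvgX].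
Qed.

Let geo_le N (u v : R) : 0 <= u -> u <= v -> geo N u <= geo N v.
Proof. by move=> u0 uv; apply: ler_sum => i _; rewrite lerXn2r// nnegrE (le_trans u0). Qed.

(** Derivative of the exponential at 0 along a sequence, by the squeeze
    [x <= expR x - 1 <= x * expR x]; the upper bound is [1 - x <= expR (- x)] multiplied by
    [expR x]. *)
Lemma cvg_expR_quotient (e x : R^nat) (c : R) : (forall n, 0 < e n) ->
  e n @[n --> \oo] --> (0 : R) -> x n / e n @[n --> \oo] --> c ->
  (expR (x n) - 1) / e n @[n --> \oo] --> c.
Proof.
move=> e0 ecv xe.
have x0 : x n @[n --> \oo] --> (0 : R).
  rewrite -(mulr0 c) (_ : (fun n => x n) = (fun n => x n / e n * e n)).
    exact: cvgM.
  by apply/funext => n; rewrite divfK// gt_eqF.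
have ex1 : expR (x n) @[n --> \oo] --> (1 : R).
  by rewrite -expR0; exact: (cvg_comp _ _ x0 (@continuous_expR R 0)).
apply: (@squeeze_cvgr _ _ _ _ (fun n => x n / e n) (fun n => x n / e n * expR (x n))) => //.
- apply: nearW => n; rewrite [X in _ && (_ <= X)]mulrAC !ler_pM2r ?invr_gt0//.
  rewrite lerBrDl expR_ge1Dx/=.
  have := expR_ge1Dx (- x n); have := expRxMexpNx_1 (x n); have := expR_gt0 (x n).
  move: (expR (x n)) (expR (- x n)) => y z y0 yz z1.
  have : y * (1 - x n) <= 1 by rewrite -[leRHS]yz ler_pM2l.
  lra.
- by rewrite -[X in _ --> X]mulr1; exact: cvgM.
Qed.

Lemma pgf_moments (X : T -> R) (k : nat) (mu : nat -> R) :
  measurable_fun setT X -> (forall w, X w \is a Num.nat) ->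
  (forall u, 0 < u < 1 -> (\int[P]_w (u `^ X w)%:E =
     (expR (\sum_(1 <= j < k.+1) mu j * (u ^+ j - 1)))%:E)%E) ->
  (\int[P]_w (X w)%:E = (\sum_(1 <= j < k.+1) j%:R * mu j)%:E)%E /\
  (\int[P]_w (X w ^+ 2)%:E = ((\sum_(1 <= j < k.+1) j%:R * mu j) ^+ 2 +
     \sum_(1 <= j < k.+1) j%:R ^+ 2 * mu j)%:E)%E.
Proof.
move=> mX natX pgf.
(* Starting at [1 / 2] keeps [u n = 1 - e n] strictly between 0 and 1, where [pgf] is available. *)
pose e n : R := (n.+2)%:R^-1.
have e0 n : 0 < e n by rewrite invr_gt0.
have e1 n : e n < 1 by rewrite invf_lt1// ltr1n.
have ecv : e n @[n --> \oo] --> (0 : R).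
  have := @cvg_div_natS R 1 1; apply: cvg_trans; apply: near_eq_cvg; apply: nearW => n.
  by rewrite mul1r addn2.
pose u n := 1 - e n.
have u01 n : 0 < u n < 1 by rewrite /u; have := e0 n; have := e1 n; lra.
have u0 n : 0 <= u n by have /andP[/ltW] := u01 n.
have ucv : u n @[n --> \oo] --> (1 : R).
  by rewrite -[X in _ --> X]subr0; apply: cvgB => //; exact: cvg_cst.
have und m n : (m <= n)%N -> u m <= u n.
  by move=> mn; rewrite lerD2l lerN2 lef_pV2 ?posrE// ler_nat.
pose S n w := (1 - u n `^ X w) / e n.
have SE n w : S n w = geo (Num.truncn (X w)) (u n).
  rewrite /S -[in LHS](truncnK (natX w)) powR_mulrn// geoE /u opprB addrCA subrr addr0.
  by rewrite mulrAC divff ?mul1r// gt_eqF.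
have S0 n w : 0 <= S n w by rewrite SE; apply: sumr_ge0 => i _; rewrite exprn_ge0.
have mpow v : 0 < v -> measurable_fun setT (fun w => v `^ X w).
  by move=> v0; exact: (measurableT_comp (measurable_powR_exponent v0) mX).
have mS n : measurable_fun setT (S n).
  apply: measurable_funM => //; apply: measurable_funB => //.
  by apply: mpow; have /andP[] := u01 n.
have Snd w : {homo (fun n => S n w) : m n / (m <= n)%N >-> m <= n}.
  by move=> m n mn; rewrite !SE; apply: geo_le => //; exact: und.
have Scv w : S n w @[n --> \oo] --> X w.
  rewrite -[X in _ --> X](truncnK (natX w)).
  under eq_cvg do rewrite SE.
  exact: cvg_geo.
pose a n := \sum_(1 <= j < k.+1) mu j * (u n ^+ j - 1).
pose c1 := \sum_(1 <= j < k.+1) j%:R * mu j.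
pose c2 := \sum_(1 <= j < k.+1) j%:R ^+ 2 * mu j.
have acv : a n / e n @[n --> \oo] --> - c1.
  rewrite /c1 (_ : (fun n => _) =
      fun n => \sum_(1 <= j < k.+1) - (geo j (u n) * mu j)); last first.
    apply/funext => n; rewrite /a mulr_suml; apply: eq_bigr => j _.
    rewrite -opprB geoE /u opprB addrCA subrr addr0.
    by field; rewrite gt_eqF.
  rewrite -sumrN; apply: cvg_big => [|j _]; first exact: add_continuous.
  apply: cvgN; apply: cvgM => //; last exact: cvg_cst.
  exact: cvg_geo.
have e2cv : e n ^+ 2 @[n --> \oo] --> (0 : R).
  by rewrite -[X in _ --> X](expr0n _ 2); exact: cvgX.
(* The square of [S n] involves the generating function at [u] and at [u^2]. As
   [u^(2j) - 1 = 2 (u^j - 1) + (1 - u^j)^2], the exponent at [u^2] is [2 * a n + dd n]; the part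
   [a n] produces the squared mean and [dd n], of order [e n ^+ 2], produces [c2]. *)
pose dd n := \sum_(1 <= j < k.+1) mu j * (1 - u n ^+ j) ^+ 2.
have ddcv : dd n / e n ^+ 2 @[n --> \oo] --> c2.
  rewrite /c2 (_ : (fun n => _) =
      fun n => \sum_(1 <= j < k.+1) (geo j (u n) ^+ 2 * mu j)); last first.
    apply/funext => n; rewrite /dd mulr_suml; apply: eq_bigr => j _.
    rewrite geoE /u opprB addrCA subrr addr0.
    by field; rewrite gt_eqF.
  apply: cvg_big => [|j _]; first exact: add_continuous.
  apply: cvgM => //; last exact: cvg_cst.
  by apply: cvgX; exact: cvg_geo.
(* Such an equation excludes infinite [x], so the moments of [S n] are found without prior
   integrability. *)
have solve_E (x : \bar R) (c r s : R) : 0 < c -> (c%:E * x + r%:E = s%:E)%E ->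
    x = ((s - r) / c)%:E.
  move=> c0; case: x => [x| |]; last 2 first.
  - by rewrite mulry gtr0_sg// mul1e addye.
  - by rewrite mulrNy gtr0_sg// mul1e addNye.
  by rewrite -EFinM -EFinD => -[<-]; congr EFin; field; rewrite gt_eqF.
have ES n : (\int[P]_w (S n w)%:E = ((1 - expR (a n)) / e n)%:E)%E.
  have /andP[un0 _] := u01 n.
  apply: solve_E => //; rewrite -pgf// -ge0_integralZl_EFin//; last 3 first.
  - by move=> w _; rewrite lee_fin.
  - exact/measurable_EFinP.
  - exact: ltW.
  rewrite -ge0_integralD//; last 4 first.
  - by move=> w _; rewrite mule_ge0 ?lee_fin ?S0 ?(ltW (e0 n)).
  - by apply: emeasurable_funM => //; exact/measurable_EFinP.
  - by move=> w _; rewrite lee_fin powR_ge0.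
  - by apply/measurable_EFinP; exact: mpow.
  under eq_integral.
    move=> w _; rewrite -EFinM -EFinD /S mulrC divfK ?gt_eqF// subrK; over.
  by rewrite integral_cst// [X in (_ * X)%E](@probability_setT _ _ _ P) mule1.
have ES2 n : (\int[P]_w (S n w ^+ 2)%:E =
    (((1 - expR (a n)) / e n) ^+ 2 + expR (2 * a n) * ((expR (dd n) - 1) / e n ^+ 2))%:E)%E.
  have /andP[un0 un1] := u01 n.
  have bE : \sum_(1 <= j < k.+1) mu j * ((u n ^+ 2) ^+ j - 1) = 2 * a n + dd n.
    rewrite /a /dd mulr_sumr -big_split/=; apply: eq_bigr => j _.
    by rewrite exprAC; ring.
  have uX2 w : (u n `^ X w) ^+ 2 = (u n ^+ 2) `^ X w.
    by rewrite -powR_mulrn ?powR_ge0// powRAC powR_mulrn// ltW.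
  have -> : ((1 - expR (a n)) / e n) ^+ 2 + expR (2 * a n) * ((expR (dd n) - 1) / e n ^+ 2)
      = (1 + expR (2 * a n + dd n) - 2 * expR (a n)) / e n ^+ 2.
    by rewrite expRD (expRM_natl 2); field; rewrite gt_eqF.
  have en2 : 0 < e n ^+ 2 by rewrite exprn_gt0.
  have u2 : 0 < u n ^+ 2 < 1 by rewrite exprn_gt0// expr_lt1// ltW.
  apply: solve_E => //; rewrite [X in (_ + X)%E]EFinM [RHS]EFinD -bE -(pgf _ u2) -(pgf _ (u01 n)).
  rewrite -ge0_integralZl_EFin//; last 3 first.
  - by move=> w _; rewrite lee_fin sqr_ge0.
  - by apply/measurable_EFinP; exact: measurable_funX.
  - exact: ltW.
  rewrite -ge0_integralZl_EFin//; last 2 first.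
  - by move=> w _; rewrite lee_fin powR_ge0.
  - by apply/measurable_EFinP; exact: mpow.
  rewrite -[X in _ = (X + _)%E]mule1 -[X in _ = (_ * X + _)%E](@probability_setT _ _ _ P).
  rewrite -integral_cst// -ge0_integralD//; last 4 first.
  - by move=> w _; rewrite mule_ge0 ?lee_fin ?sqr_ge0.
  - by apply: emeasurable_funM => //; apply/measurable_EFinP; exact: measurable_funX.
  - by move=> w _; rewrite mule_ge0 ?lee_fin ?powR_ge0.
  - by apply: emeasurable_funM => //; apply/measurable_EFinP; exact: mpow.
  rewrite -ge0_integralD//; last 2 first.
  - by move=> w _; rewrite lee_fin powR_ge0.
  - by apply/measurable_EFinP; apply: mpow; exact: exprn_gt0.
  apply: eq_integral => w _; rewrite -!EFinM -!EFinD; congr EFin.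
  by rewrite /S -uX2; field; rewrite gt_eqF.
have eacv := cvg_expR_quotient e0 ecv acv.
split.
- have : (\int[P]_w (S n w)%:E)%E @[n --> \oo] --> (\int[P]_w (X w)%:E)%E.
    rewrite (_ : (\int[P]_w (X w)%:E)%E = (\int[P]_w (limn (fun n => (S n w)%:E)))%E).
      apply: cvg_monotone_convergence => //.
      + by move=> n; exact/measurable_EFinP.
      + by move=> n w _; rewrite lee_fin.
      + by move=> w _ m n mn; rewrite lee_fin Snd.
    apply: eq_integral => w _; apply/esym/cvg_lim => //.
    by apply: cvg_EFin; [exact: nearW|exact: Scv].
  rewrite (funext ES) => H; apply: (cvg_unique _ H) => //.
  apply: cvg_EFin; first exact: nearW.
  rewrite (_ : fine \o _ = (fun n => - ((expR (a n) - 1) / e n))); last first.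
    by apply/funext => n /=; rewrite -mulNr opprB.
  by rewrite -[X in _ --> X]opprK; exact: cvgN.
- have : (\int[P]_w (S n w ^+ 2)%:E)%E @[n --> \oo] --> (\int[P]_w (X w ^+ 2)%:E)%E.
    rewrite (_ : (\int[P]_w (X w ^+ 2)%:E)%E = (\int[P]_w (limn (fun n => (S n w ^+ 2)%:E)))%E).
      apply: cvg_monotone_convergence => //.
      + by move=> n; apply/measurable_EFinP; exact: measurable_funX.
      + by move=> n w _; rewrite lee_fin sqr_ge0.
      + by move=> w _ m n mn; rewrite lee_fin lerXn2r ?nnegrE// Snd.
    apply: eq_integral => w _; apply/esym/cvg_lim => //.
    by apply: cvg_EFin; [exact: nearW|apply: cvgX; exact: Scv].
  rewrite (funext ES2) => H; apply: (cvg_unique _ H) => //.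
  apply: cvg_EFin; first exact: nearW.
  rewrite (_ : fine \o _ = (fun n => ((expR (a n) - 1) / e n) ^+ 2
     + expR (a n) ^+ 2 * ((expR (dd n) - 1) / e n ^+ 2))); last first.
    apply/funext => n /=; rewrite -(expRM_natl 2) -(sqrrN (_ / _)) -mulNr opprB//.
  rewrite -/c1 -/c2 -(sqrrN c1) -[X in _ + X]mul1r; apply: cvgD.
    exact: cvgX.
  apply: cvgM; last first.
    by apply: cvg_expR_quotient => // n; rewrite exprn_gt0.
  rewrite -(expr1n _ 2); apply: cvgX.
  rewrite -expR0.
  suff a0 : a n @[n --> \oo] --> (0 : R) by exact: (cvg_comp _ _ a0 (@continuous_expR R 0)).
  rewrite -(mulr0 (- c1)) (_ : (fun n => _) = (fun n => a n / e n * e n)).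
    exact: cvgM.
  by apply/funext => n; rewrite divfK// gt_eqF.
Qed.
End pgf_moments.

(** * Integral identities for the increments of a Levy process *)

Section levy.
Context d (T : measurableType d) (R : realType) (P : probability T R).
Variable M : R -> {RV P >-> R}.
Hypothesis hM : is_levy_process M.

Let measurable_incr s t : measurable_fun setT (incr M s t).
Proof. by apply: measurable_funB; exact: measurable_funPT. Qed.

Lemma levy_indep2 (a b c : R) (A B : set R) : 0 <= a -> a < b -> b < c ->
  measurable A -> measurable B ->
  P (incr M a b @^-1` A `&` incr M b c @^-1` B) =
  (P (incr M a b @^-1` A) * P (incr M b c @^-1` B))%E.
Proof.
move=> a0 ab bc mA mB.
(* The default value of [nth] supplies the third time, [t 2 = c]. *)
pose t i := nth c [:: a; b] i.
have tS i : (i < 2)%N -> t i < t i.+1 by case: i => [|[|]].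
have := levy_independent_increments hM (t := t) a0 tS
  (B := fun i : 'I_2 => if i == ord0 then A else B).
rewrite !big_ord_recl big_ord0 mule1 /= => <-.
  congr (P _); apply/seteqP; split => w /=.
    by move=> [Aw Bw] [[|[|]]]//.
  by move=> H; split; [exact: (H ord0)|exact: (H (lift ord0 ord0))].
by move=> i; case: ifP.
Qed.

Lemma levy_incr_law (s t : R) (f : R -> \bar R) : 0 <= s -> 0 <= t ->
  measurable_fun setT f -> (forall x, 0 <= f x)%E ->
  (\int[P]_w f (incr M s (s + t) w) = \int[P]_w f (M t w))%E.
Proof.
move=> s0 t0 mf f0.
rewrite (@ge0_integral_comp_eq_law _ _ _ P (incr M s (s + t)) (incr M 0 t))//.
- apply: ge0_ae_eq_integral => //.
  + by apply: measurableT_comp => //; exact: measurable_incr.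
  + by apply: measurableT_comp => //; exact: measurable_funPT.
  + apply: filterS (levy_start hM) => w w0 _.
    by rewrite /incr w0 subr0.
- by move=> B mB; exact: levy_stationary_increments.
Qed.

(** Since [M 0 = 0] almost surely, [M s] is the increment over [[0, s]], independent of the adjacent
    one, which has the law of [M t]. *)
Lemma levy_integral_mul (s t : R) (f g : R -> \bar R) : 0 < s -> 0 < t ->
  measurable_fun setT f -> measurable_fun setT g ->
  (forall x, 0 <= f x)%E -> (forall x, 0 <= g x)%E ->
  (\int[P]_w (f (M s w) * g (incr M s (s + t) w)) =
   \int[P]_w f (M s w) * \int[P]_w g (M t w))%E.
Proof.
move=> s0 t0 mf mg f0 g0.
rewrite -(levy_incr_law (lexx 0) (ltW s0) mf f0) -(levy_incr_law (ltW s0) (ltW t0) mg g0).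
rewrite add0r -ge0_integral_mul_indep//; last first.
  by move=> A B mA mB; apply: levy_indep2 => //; rewrite ltrDl.
apply: ge0_ae_eq_integral => //.
- by apply: emeasurable_funM; apply: measurableT_comp => //; exact: measurable_funPT.
- by apply: emeasurable_funM; apply: measurableT_comp => //.
- by move=> w _; rewrite mule_ge0.
- by move=> w _; rewrite mule_ge0.
- by apply: filterS (levy_start hM) => w w0 _; rewrite [incr M 0 s w]/incr w0 subr0.
Qed.

End levy.

(** * The generating function of the counting process *)

Section gcp_pgf.
Context d (T : measurableType d) (R : realType) (P : probability T R).
Variables (k : nat) (l : nat -> R) (M : R -> {RV P >-> R}).
Hypothesis hM : is_gcp k l M.

Let hL : is_levy_process M := gcp_levy hM.

(** The row of the infinitesimal generator at state 0, restricted to the states up to [k]. *)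
Let rate (j : nat) : R := if j == 0%N then - \sum_(1 <= i < k.+1) l i else l j.

Let p (j : nat) (h : R) : R := fine (P (M h @^-1` [set j%:R])).

Let mMset t j : measurable (M t @^-1` [set j%:R]).
Proof. by rewrite -[_ @^-1` _]setTI; exact: measurable_funPT. Qed.

Let pE j h : (p j h)%:E = P (M h @^-1` [set j%:R]).
Proof. by rewrite /p fineK// fin_num_measure. Qed.

Let P_M0I (A : set T) : measurable A -> P (A `&` M 0 @^-1` [set 0]) = P A.
Proof.
move=> mA; have [N [mN N0 subN]] := levy_start hL.
have m0 : measurable (M 0 @^-1` [set 0]) by exact: (mMset 0 0%N).
have A0 : P (A `\` M 0 @^-1` [set 0]) = 0%E.
  apply: subset_measure0 N0 => //; first exact: measurableD.
  by move=> w [_ /= w0]; apply: subN.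
rewrite -[in RHS](setUIDK A (M 0 @^-1` [set 0])) measureU0//.
exact: measurableD.
Qed.

(** The transition law at time 0 and state 0: there the conditioning event has probability one, so
    the conditional probability is [p j h] itself. *)
Let transition0 (j : nat) : (j <= k)%N ->
  (p j h - (j == 0%N)%:R) / h @[h --> 0^'+] --> rate j.
Proof.
move=> jk.
have P0 : P (M 0 @^-1` [set 0]) = 1%E.
  by rewrite -[X in P X]setTI P_M0I// probability_setT.
have := @gcp_transition _ _ _ _ _ _ _ hM 0 0%N j (lexx 0).
rewrite P0 => /(_ (oner_neq0 _)) /eqoP H.
apply/cvgrPdist_le => e e0; near=> h.
have h0 : 0 < h by [].
have : `|p j h - (if j == 0%N then 1 - (\sum_(1 <= i < k.+1) l i) * h
          else if (j <= k)%N then l j * h else 0)| <= e * `|h|.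
  near: h; move: (H e e0); apply: filterS => h.
  by rewrite /cond_prob add0n add0r P0/= divr1 P_M0I.
rewrite jk => pj; set c := (X in p j h - X) in pj.
have -> : rate j - (p j h - (j == 0%N)%:R) / h = - ((p j h - c) / h).
  by rewrite /rate /c; case: eqP => _ /=; field; rewrite gt_eqF.
by rewrite normrN normf_div ler_pdivrMr// normr_gt0 gt_eqF.
Unshelve. all: by end_near. Qed.

(** For [h >= 0], this is [v ^ M h] cut off to zero where [M h > k]. It serves at [v = u] and at
    [v = 1], where it is the indicator of [M h <= k]. *)
Let s_ (v h : R) (w : T) : R :=
  \sum_(j < k.+1) v ^+ j * \1_(M h @^-1` [set j%:R]) w.

Let s_E v h w N : M h w = N%:R -> s_ v h w = if (N < k.+1)%N then v ^+ N else 0.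
Proof.
move=> MN; have indN j : \1_(M h @^-1` [set j%:R]) w = (N == j)%:R :> R.
  rewrite indicE; congr (_%:R); congr nat_of_bool; apply/idP/eqP => [|Nj].
    by rewrite inE /= MN => /eqP; rewrite eqr_nat => /eqP.
  by rewrite inE /= MN Nj.
rewrite /s_; under eq_bigr do rewrite indN.
case: ifPn => Nk.
  rewrite (bigD1 (Ordinal Nk))//= eqxx mulr1 big1 ?addr0// => j jN.
  by rewrite eq_sym [(_ == _)%N](negbTE jN) mulr0.
by rewrite big1// => j _; case: eqP => [Nj|_]; [rewrite Nj ltn_ord in Nk|rewrite mulr0].
Qed.

Let s_ge0 v h w : 0 <= v -> 0 <= s_ v h w.
Proof. by move=> v0; apply: sumr_ge0 => j _; rewrite mulr_ge0 ?exprn_ge0. Qed.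

Let measurable_s_ v h : measurable_fun setT (s_ v h).
Proof.
by apply: measurable_sum => j; apply: measurable_funM.
Qed.

Let integral_s_ v h : 0 <= v ->
  (\int[P]_w (s_ v h w)%:E = (\sum_(j < k.+1) v ^+ j * p j h)%:E)%E.
Proof.
move=> v0; under eq_integral do rewrite /s_ -sumEFin.
rewrite ge0_integral_sum//; last 2 first.
- by move=> j; apply/measurable_EFinP; exact: measurable_funM.
- by move=> j w _; rewrite lee_fin mulr_ge0 ?exprn_ge0.
rewrite -sumEFin; apply: eq_bigr => j _; rewrite EFinM pE.
under eq_integral do rewrite EFinM.
rewrite ge0_integralZl_EFin ?exprn_ge0//.
- by rewrite integral_indic// setIT.
- by apply/measurable_EFinP; exact: measurable_indic.
Qed.

Let mpow u : 0 < u -> measurable_fun setT (fun x : R => (u `^ x)%:E).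
Proof. by move=> u0; apply/measurable_EFinP; exact: measurable_powR_exponent. Qed.

Let mpowM u t : 0 < u -> measurable_fun setT (fun w => (u `^ M t w)%:E).
Proof. by move=> u0; apply: measurableT_comp (mpow u0) _; exact: measurable_funPT. Qed.

Let powMn u t w N : 0 < u -> M t w = N%:R -> u `^ M t w = u ^+ N.
Proof. by move=> u0 ->; rewrite powR_mulrn// ltW. Qed.

Let G u t : R := fine (\int[P]_w (u `^ M t w)%:E)%E.

Let natM t w : 0 <= t -> exists N, M t w = N%:R.
Proof. by move=> t0; apply/natrP; exact: (gcp_nat_valued hM). Qed.

Let GE u t : 0 < u < 1 -> 0 <= t -> (\int[P]_w (u `^ M t w)%:E)%E = (G u t)%:E.
Proof.
move=> /andP[u0 u1] t0; rewrite /G fineK// ge0_fin_numE; last first.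
  by apply: integral_ge0 => w _; rewrite lee_fin powR_ge0.
apply: (@le_lt_trans _ _ (\int[P]_w (cst 1%E w))%E); last first.
  by rewrite integral_cst// mul1e [X in (X < _)%E](@probability_setT _ _ _ P) ltry.
apply: ge0_le_integral => //.
- by move=> w _; rewrite lee_fin powR_ge0.
- exact: mpowM.
- move=> w _; rewrite lee_fin; have [N MN] := natM w t0.
  by rewrite (powMn u0 MN) exprn_ile1// ltW.
Qed.

Let G_lower u h : 0 < u < 1 -> 0 <= h -> \sum_(j < k.+1) u ^+ j * p j h <= G u h.
Proof.
move=> u01 h0; have /andP[u0 u1] := u01; have u0' := ltW u0.
rewrite -lee_fin -integral_s_// -GE//; apply: ge0_le_integral => //.
- by move=> w _; rewrite lee_fin s_ge0.
- exact/measurable_EFinP.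
- exact: mpowM.
- move=> w _; rewrite lee_fin; have [N MN] := natM w h0.
  by rewrite (powMn u0 MN) (s_E _ MN); case: ifP => // _; rewrite exprn_ge0.
Qed.

(** The part of [G u h] carried by [M h > k] is at most [P (M h > k)], because [u ^ M h <= 1].
    Pointwise, the two sides agree where [M h <= k] and read [u ^ M h <= 1] elsewhere. *)
Let G_upper u h : 0 < u < 1 -> 0 <= h ->
  G u h + \sum_(j < k.+1) p j h <= \sum_(j < k.+1) u ^+ j * p j h + 1.
Proof.
move=> u01 h0; have /andP[u0 u1] := u01; have u0' := ltW u0.
have -> : \sum_(j < k.+1) p j h = \sum_(j < k.+1) 1 ^+ j * p j h.
  by apply: eq_bigr => j _; rewrite expr1n mul1r.
rewrite -lee_fin !EFinD -!integral_s_// -GE//.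
rewrite -[X in (_ <= _ + X)%E](@probability_setT _ _ _ P) -[P setT]mul1e.
rewrite -integral_cst// -!ge0_integralD//; [|by move=> w _; rewrite lee_fin s_ge0
  |exact/measurable_EFinP|by move=> w _; rewrite lee_fin powR_ge0|exact: mpowM
  |by move=> w _; rewrite lee_fin s_ge0|exact/measurable_EFinP].
apply: ge0_le_integral => //.
- by move=> w _; rewrite -EFinD lee_fin addr_ge0 ?powR_ge0 ?s_ge0.
- by apply: emeasurable_funD; [exact: mpowM|exact/measurable_EFinP].
- by apply: emeasurable_funD => //; exact/measurable_EFinP.
- move=> w _; rewrite -!EFinD lee_fin; have [N MN] := natM w h0.
  rewrite (powMn u0 MN) !(s_E _ MN); case: ifP => // _; first by rewrite expr1n.
  by rewrite addr0 add0r exprn_ile1// ltW.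
Qed.

Let phi u := \sum_(1 <= j < k.+1) l j * (u ^+ j - 1).

Let sum_rate u : \sum_(j < k.+1) u ^+ j * rate j = phi u.
Proof.
rewrite big_ord_recl expr0 mul1r /rate eqxx /phi.
rewrite !big_add1/= !big_mkord -sumrN -big_split/=; apply: eq_bigr => j _.
by rewrite /bump; ring.
Qed.

Let sum_rate0 : \sum_(j < k.+1) rate j = 0.
Proof.
transitivity (\sum_(j < k.+1) 1 ^+ j * rate j).
  by apply: eq_bigr => j _; rewrite expr1n mul1r.
by rewrite sum_rate /phi big1// => j _; rewrite expr1n subrr mulr0.
Qed.

Let dG0 u : 0 < u < 1 -> (G u h - 1) / h @[h --> 0^'+] --> phi u.
Proof.
move=> u01.
have delta0 (v : R) : \sum_(j < k.+1) v ^+ j * ((j : nat) == 0%N)%:R = 1.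
  by rewrite big_ord_recl expr0 mul1r big1 ?addr0// => j _; rewrite mulr0.
pose q j h := (p j h - (j == 0%N)%:R) / h.
(* The bounds come from [G_lower] and [G_upper]. They differ by the sum of the [q j h], which tends
   to the total of the rates, that is 0; hence both tend to [phi u]. *)
apply: (@squeeze_cvgr _ _ _ _ (fun h => \sum_(j < k.+1) u ^+ j * q j h)
                              (fun h => \sum_(j < k.+1) (u ^+ j - 1) * q j h)).
- near=> h; have h0 : 0 < h by [].
  have -> : \sum_(j < k.+1) u ^+ j * q j h = (\sum_(j < k.+1) u ^+ j * p j h - 1) / h.
    rewrite -[X in _ - X](delta0 u) -sumrB mulr_suml; apply: eq_bigr => j _.
    by rewrite /q mulrA mulrBr.
  have -> : \sum_(j < k.+1) (u ^+ j - 1) * q j h =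
      (\sum_(j < k.+1) u ^+ j * p j h - \sum_(j < k.+1) p j h) / h.
    transitivity (((\sum_(j < k.+1) u ^+ j * p j h - 1)
      - (\sum_(j < k.+1) p j h - \sum_(j < k.+1) 1 ^+ j * ((j : nat) == 0%N)%:R)) / h).
      rewrite -[X in _ - X - _](delta0 u) -!sumrB mulr_suml; apply: eq_bigr => j _.
      by rewrite /q expr1n; ring.
    by rewrite delta0; congr (_ / _); ring.
  rewrite !ler_pM2r ?invr_gt0//.
  have := G_lower u01 (ltW h0); have := G_upper u01 (ltW h0).
  by move=> *; apply/andP; split; lra.
- rewrite -sum_rate; apply: cvg_big => //; first exact: add_continuous.
  by move=> j _; apply: cvgM; [exact: cvg_cst|apply: transition0; rewrite -ltnS].
- have -> : phi u = \sum_(j < k.+1) (u ^+ j - 1) * rate j.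
    under [RHS]eq_bigr do rewrite mulrBl mul1r.
    by rewrite sumrB sum_rate0 subr0 sum_rate.
  apply: cvg_big => //; first exact: add_continuous.
  by move=> j _; apply: cvgM; [exact: cvg_cst|apply: transition0; rewrite -ltnS].
Unshelve. all: by end_near. Qed.

Let GD u s t : 0 < u < 1 -> 0 < s -> 0 < t -> G u (s + t) = G u s * G u t.
Proof.
move=> u01 s0 t0; have /andP[u0 u1] := u01.
apply: EFin_inj; rewrite EFinM -!GE ?addr_ge0 ?ltW//.
rewrite -(levy_integral_mul hL s0 t0 (mpow u0) (mpow u0)); last 2 first.
- by move=> x; rewrite lee_fin powR_ge0.
- by move=> x; rewrite lee_fin powR_ge0.
apply: eq_integral => w _; rewrite -EFinM -powRD; last by rewrite (gt_eqF u0) implybT.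
by rewrite /incr (addrC (M s w)) subrK.
Qed.

Let GX u t n : 0 < u < 1 -> 0 < t -> G u (n.+1%:R * t) = G u t ^+ n.+1.
Proof.
move=> u01 t0; elim: n => [|n IH]; first by rewrite mul1r expr1.
by rewrite -natr1 mulrDl mul1r GD// ?mulr_gt0// IH -exprSr.
Qed.

(** The right derivative at 0 suffices: [G u t] is the [(n + 1)]-st power of [G u (h n)] with
    [h n = t / (n + 1)], so [ln (G u t) = (t / h n) * ln (G u (h n))], and
    [1 - 1 / g <= ln g <= g - 1] squeezes this constant to [t * phi u]. The logarithm is legitimate
    because [G u (h n)] tends to 1 and is eventually positive. *)
Lemma gcp_pgf u t : 0 < u < 1 -> 0 <= t ->
  (\int[P]_w (u `^ M t w)%:E =
   (expR (\sum_(1 <= j < k.+1) t * l j * (u ^+ j - 1)))%:E)%E.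
Proof.
move=> u01; have /andP[u0 u1] := u01; rewrite le_eqVlt => /predU1P[<-|t0].
  rewrite big1 => [|j _]; last by rewrite !mul0r.
  rewrite expR0 (@ge0_ae_eq_integral _ _ _ _ _ _ (cst 1%E))//.
  - by rewrite integral_cst// mul1e [X in X = _](@probability_setT _ _ _ P).
  - exact: mpowM.
  - by move=> w _; rewrite lee_fin powR_ge0.
  - by apply: filterS (levy_start hL) => w w0 _; rewrite w0 powRr0.
have -> : \sum_(1 <= j < k.+1) t * l j * (u ^+ j - 1) = t * phi u.
  by rewrite /phi mulr_sumr; apply: eq_bigr => j _; rewrite mulrA.
rewrite GE ?ltW//; congr EFin.
pose h n : R := t / n.+1%:R.
have h0 n : 0 < h n by rewrite divr_gt0.
have hcv : h n @[n --> \oo] --> (0 : R).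
  by have := @cvg_div_natS R t 0; under eq_cvg do rewrite addn1.
have dG : (G u (h n) - 1) / h n @[n --> \oo] --> phi u.
  exact: ((cvg_at_rightP _ _ _).1 (dG0 u01)).
have G1 : G u (h n) @[n --> \oo] --> (1 : R).
  rewrite -(addr0 1) -(mulr0 (phi u)).
  rewrite (_ : (fun n => _) = (fun n => 1 + (G u (h n) - 1) / h n * h n)).
    by apply: cvgD; [exact: cvg_cst|exact: cvgM].
  by apply/funext => n; rewrite divfK ?gt_eqF// addrC subrK.
have GXt n : G u t = G u (h n) ^+ n.+1.
  by rewrite -GX// /h mulrC divfK// gt_eqF.
have Gpos : \forall n \near \oo, 0 < G u (h n) by exact: (cvgr_gt 1 G1).
have Gt0 : 0 < G u t.
  by near \oo => n; rewrite (GXt n) exprn_gt0//; near: n.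
have lnG : ln (G u t) = t * phi u.
  have c1 : (fun=> ln (G u t)) n @[n --> \oo] --> ln (G u t) by exact: cvg_cst.
  have c2 : (fun=> ln (G u t)) n @[n --> \oo] --> t * phi u.
    apply: (@squeeze_cvgr _ _ _ _ (fun n => t * ((G u (h n) - 1) / h n) / G u (h n))
                                  (fun n => t * ((G u (h n) - 1) / h n))).
    - near=> n; have g0 : 0 < G u (h n) by near: n.
      rewrite (GXt n) lnXn// -mulr_natr.
      have -> : (n.+1%:R : R) = t / h n by rewrite /h invf_div mulrCA divff ?mulr1// gt_eqF.
      move: g0; move: (G u (h n)) => g g0.
      have lng : ln g <= g - 1.
        by have := @le_ln1Dx R (g - 1); rewrite (addrC 1) subrK; apply; rewrite ltrBrDl subrr.
      have lng' : 1 - g^-1 <= ln g.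
        have := @le_ln1Dx R (g^-1 - 1); rewrite (addrC 1) subrK lnV ?posrE//.
        by rewrite ltrBrDl subrr invr_gt0 => /(_ g0); lra.
      have c0 : 0 < t / h n by rewrite divr_gt0.
      have -> : t * ((g - 1) / h n) / g = (1 - g^-1) * (t / h n).
        by field; rewrite !gt_eqF.
      have -> : t * ((g - 1) / h n) = (g - 1) * (t / h n) by ring.
      by rewrite !ler_pM2r// lng lng'.
    - rewrite -[X in _ --> X]divr1; apply: cvgM; last exact: cvgV.
      by apply: cvgM => //; exact: cvg_cst.
    - by apply: cvgM => //; exact: cvg_cst.
  exact: (cvg_unique _ c1 c2).
by rewrite -lnG lnK// posrE.
Unshelve. all: by end_near. Qed.

End gcp_pgf.

(** * Mean and product moments of the counting process *)

Section gcp_moments.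
Context d (T : measurableType d) (R : realType) (P : probability T R).
Variables (k : nat) (l : nat -> R) (M : R -> {RV P >-> R}).
Hypothesis hM : is_gcp k l M.

Let hL : is_levy_process M := gcp_levy hM.
Let c1 := \sum_(1 <= j < k.+1) j%:R * l j.
Let c2 := \sum_(1 <= j < k.+1) j%:R ^+ 2 * l j.

Lemma gcp_ge0 t w : 0 <= t -> 0 <= M t w.
Proof. by move=> t0; apply: natr_ge0; exact: (gcp_nat_valued hM). Qed.

Let moments t : 0 <= t -> (\int[P]_w (M t w)%:E = (c1 * t)%:E)%E /\
  (\int[P]_w (M t w ^+ 2)%:E = ((c1 * t) ^+ 2 + c2 * t)%:E)%E.
Proof.
move=> t0.
have [] := @pgf_moments _ _ _ P (M t) k (fun j => t * l j).
- exact: measurable_funPT.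
- by move=> w; exact: (gcp_nat_valued hM).
- by move=> u u01; exact: gcp_pgf.
have -> : \sum_(1 <= j < k.+1) j%:R * (t * l j) = c1 * t.
  by rewrite mulr_suml; apply: eq_bigr => j _; rewrite mulrCA mulrC.
have -> : \sum_(1 <= j < k.+1) j%:R ^+ 2 * (t * l j) = c2 * t.
  by rewrite mulr_suml; apply: eq_bigr => j _; rewrite mulrCA mulrC.
by split.
Qed.

Lemma gcp_mean t : 0 <= t -> (\int[P]_w (M t w)%:E = (c1 * t)%:E)%E.
Proof. by move=> /moments[]. Qed.

(** Write [M s * M (s + t)] as [M s ^+ 2] plus [M s] times the increment after [s], and use
    independence on the second term. *)
Let mul_lt s t : 0 < s -> 0 < t ->
  (\int[P]_w (M s w * M (s + t) w)%:E = (c1 ^+ 2 * s * (s + t) + c2 * s)%:E)%E.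
Proof.
move=> s0 t0; have [m1 m2] := moments (ltW s0); have [n1 n2] := moments (ltW t0).
(* The increments are nonnegative only almost surely, hence the absolute value. *)
pose f (x : R) : \bar R := `|x|%:E.
have mf : measurable_fun setT f by exact/measurable_EFinP.
have f0 x : (0 <= f x)%E by rewrite lee_fin.
have fM r w : 0 <= r -> f (M r w) = (M r w)%:E by move=> r0; rewrite /f ger0_norm// gcp_ge0.
have := levy_integral_mul hL s0 t0 mf mf f0 f0.
under [X in _ = (X * _)%E -> _]eq_integral do rewrite fM ?ltW//.
under [X in _ = (_ * X)%E -> _]eq_integral do rewrite fM ?ltW//.
rewrite m1 n1 => mul_incr.
have mIncr : measurable_fun setT (incr M s (s + t)).
  by apply: measurable_funB; exact: measurable_funPT.
have -> : c1 ^+ 2 * s * (s + t) + c2 * s = ((c1 * s) ^+ 2 + c2 * s) + (c1 * s) * (c1 * t) by ring.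
rewrite EFinD EFinM -mul_incr -m2 -ge0_integralD//; last 4 first.
- by move=> w _; rewrite lee_fin sqr_ge0.
- by apply/measurable_EFinP; apply: measurable_funX; exact: measurable_funPT.
- by move=> w _; rewrite mule_ge0.
- by apply: emeasurable_funM; apply: measurableT_comp => //; exact: measurable_funPT.
(* By stationarity a negative increment is as likely as [M t - M 0 < 0], which is impossible when
   [M 0 = 0] because [M t >= 0]. *)
have nneg : {ae P, forall w, 0 <= incr M s (s + t) w}.
  exists (incr M s (s + t) @^-1` `]-oo, 0[); split.
  - by rewrite -[_ @^-1` _]setTI; exact: mIncr.
  - rewrite (levy_stationary_increments hL (ltW s0) (ltW t0))//.
    have [N [mN N0 subN]] := levy_start hL.
    apply: subset_measure0 N0 => //.
      rewrite -[_ @^-1` _]setTI; apply: measurable_funB => //; exact: measurable_funPT.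
    move=> w; rewrite /= in_itv/= => ltw; apply: subN => /= w0; move: ltw.
    by rewrite /incr w0 subr0 ltNge gcp_ge0// ltW.
  - by move=> w /= /negP; rewrite -ltNge in_itv.
apply: ge0_ae_eq_integral => //.
- by apply/measurable_EFinP; apply: measurable_funM; exact: measurable_funPT.
- apply: emeasurable_funD.
    by apply/measurable_EFinP; apply: measurable_funX; exact: measurable_funPT.
  by apply: emeasurable_funM; apply: measurableT_comp => //; exact: measurable_funPT.
- by move=> w _; rewrite lee_fin mulr_ge0 ?gcp_ge0 ?addr_ge0 ?ltW.
- by move=> w _; rewrite adde_ge0 ?mule_ge0// lee_fin sqr_ge0.
- apply: filterS nneg => w w0 _; rewrite fM ?ltW// /f ger0_norm// -EFinM -EFinD.
  by congr EFin; rewrite /incr; ring.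
Qed.

Lemma gcp_mul_mean s r : 0 <= s -> 0 <= r ->
  (\int[P]_w (M s w * M r w)%:E = (c1 ^+ 2 * s * r + c2 * Num.min s r)%:E)%E.
Proof.
wlog sr : s r / s <= r.
  move=> H s0 r0; have /orP[sr|rs] := le_total s r; first exact: H.
  under eq_integral do rewrite mulrC.
  by rewrite H// minC; congr EFin; ring.
move=> + r0; rewrite le_eqVlt => /predU1P[<-|s0].
  rewrite (@ge0_ae_eq_integral _ _ _ _ _ _ (cst 0%E))//.
  - by rewrite integral0 (min_idPl _)// !(mulr0, mul0r) addr0.
  - by apply/measurable_EFinP; apply: measurable_funM; exact: measurable_funPT.
  - by move=> w _; rewrite lee_fin mulr_ge0 ?gcp_ge0.
  - by apply: filterS (levy_start hL) => w w0 _; rewrite w0 mul0r.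
rewrite (min_idPl _)//; move: sr; rewrite le_eqVlt => /predU1P[<-|sr].
  under eq_integral do rewrite -expr2.
  by rewrite (moments (ltW s0)).2; congr EFin; ring.
have := @mul_lt s (r - s) s0; rewrite subr_gt0 => /(_ sr).
by rewrite addrC subrK.
Qed.

End gcp_moments.

(** * Variance of the fractional integral *)

Section RL_integral_moments.
Context d (T : measurableType d) (R : realType) (P : probability T R).
Notation mu := (@lebesgue_measure R).
Variables (J : R -> T -> R) (K : R -> R) (c1 c2 : R).
Hypotheses (J0 : forall s w, 0 <= J s w)
  (mJ : measurable_fun setT (fun p : R * T => J p.1 p.2))
  (K0 : forall s, 0 <= K s) (mK : measurable_fun setT K)
  (Kneg : forall s, s < 0 -> K s = 0)
  (c1_ge0 : 0 <= c1) (c2_ge0 : 0 <= c2)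
  (meanJ : forall s, 0 <= s -> (\int[P]_w (J s w)%:E = (c1 * s)%:E)%E)
  (mulJ : forall s r, 0 <= s -> 0 <= r ->
    (\int[P]_w (J s w * J r w)%:E = (c1 ^+ 2 * s * r + c2 * Num.min s r)%:E)%E).

Let Z w := (\int[mu]_s (K s * J s w)%:E)%E.

Let mJs s : measurable_fun setT (J s).
Proof. by have := measurableT_comp mJ (measurable_pair1 s). Qed.

Let mf : measurable_fun setT (fun p : R * T => (K p.1 * J p.1 p.2)%:E).
Proof.
apply/measurable_EFinP; apply: measurable_funM => //.
by apply: measurableT_comp => //; exact: measurable_fst.
Qed.

Let f0 p : (0 <= (K p.1 * J p.1 p.2)%:E)%E.
Proof. by rewrite lee_fin mulr_ge0. Qed.

Lemma measurable_weighted_integral : measurable_fun setT Z.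
Proof. exact: (measurable_fun_fubini_tonelli_G (m1 := mu) _ mf f0). Qed.

Lemma weighted_integral_ge0 w : (0 <= Z w)%E.
Proof. by apply: integral_ge0 => s _; exact: (f0 (s, w)). Qed.

Variable A : R.
Hypothesis intK : (\int[mu]_s (K s * s)%:E = A%:E)%E.

Let Ks0 s : 0 <= K s * s.
Proof. by have [s0|s0] := ltP s 0; [rewrite Kneg// mul0r|rewrite mulr_ge0]. Qed.

Let mKs : measurable_fun setT (fun s => (K s * s)%:E).
Proof. by apply/measurable_EFinP; exact: measurable_funM. Qed.

Lemma mean_weighted_integral : (\int[P]_w Z w = (c1 * A)%:E)%E.
Proof.
rewrite /Z -(@fubini_tonelli _ _ _ _ _ mu P _ mf f0)/=.
rewrite EFinM -intK -ge0_integralZl_EFin//; last by move=> s _; rewrite lee_fin.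
apply: eq_integral => s _; have [s0|s0] := ltP s 0.
  rewrite Kneg// mul0r mule0 integral0_eq// => w _.
  by rewrite mul0r.
under eq_integral do rewrite EFinM.
rewrite ge0_integralZl_EFin//; [|by move=> w _; rewrite lee_fin|exact/measurable_EFinP].
by rewrite meanJ// -!EFinM; congr EFin; ring.
Qed.

Let mkmin : measurable_fun setT (fun p : R * R => (K p.1 * (K p.2 * Num.min p.1 p.2))%:E).
Proof.
apply/measurable_EFinP; apply: measurable_funM => //.
  by apply: measurableT_comp => //; exact: measurable_fst.
apply: measurable_funM.
  by apply: measurableT_comp => //; exact: measurable_snd.
exact: measurable_minr.
Qed.

Let kmin0 s r : 0 <= K s * (K r * Num.min s r).
Proof.
have [s0|s0] := ltP s 0; first by rewrite Kneg// mul0r.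
have [r0|r0] := ltP r 0; first by rewrite (Kneg r0) mul0r mulr0.
by rewrite !mulr_ge0// le_min s0.
Qed.

Let mean_JZ s : 0 <= s -> (\int[P]_w ((K s * J s w)%:E * Z w) =
  (c1 ^+ 2 * A * (K s * s))%:E +
  c2%:E * \int[mu]_r (K s * (K r * Num.min s r))%:E)%E.
Proof.
move=> s0.
pose g (p : R * T) : \bar R := (K s * (J s p.2 * (K p.1 * J p.1 p.2)))%:E.
have mg : measurable_fun setT g.
  apply/measurable_EFinP; apply: measurable_funM => //; apply: measurable_funM.
    by apply: measurableT_comp => //; exact: measurable_snd.
  exact/measurable_EFinP.
have g0 p : (0 <= g p)%E by rewrite lee_fin !mulr_ge0.
transitivity (\int[P]_w \int[mu]_r g (r, w))%E.
  apply: eq_integral => w _; rewrite /Z -ge0_integralZl_EFin//.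
  - by apply: eq_integral => r _; rewrite -EFinM /g/= mulrA.
  - by move=> r _; exact: (f0 (r, w)).
  - apply/measurable_EFinP; apply: measurable_funM => //.
    exact: (measurableT_comp mJ (measurable_pair2 w)).
  - by rewrite mulr_ge0.
rewrite -(@fubini_tonelli _ _ _ _ _ mu P _ mg g0)/=.
have mKmin : measurable_fun setT (fun r => (K s * (K r * Num.min s r))%:E).
  exact: (measurableT_comp mkmin (measurable_pair1 s)).
rewrite -ge0_integralZl_EFin//; last by move=> r _; rewrite lee_fin.
have -> : c1 ^+ 2 * A * (K s * s) = (c1 ^+ 2 * (K s * s)) * A by ring.
rewrite EFinM -intK -ge0_integralZl_EFin//; last 2 first.
- by move=> r _; rewrite lee_fin.
- by rewrite mulr_ge0 ?sqr_ge0.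
rewrite -ge0_integralD//; last 4 first.
- by move=> r _; rewrite mule_ge0 ?lee_fin// mulr_ge0 ?sqr_ge0.
- by apply: emeasurable_funM.
- by move=> r _; rewrite mule_ge0 ?lee_fin.
- by apply: emeasurable_funM.
apply: eq_integral => r _; rewrite -!EFinM -EFinD; have [r0|r0] := ltP r 0.
  rewrite /g/= (Kneg r0) !(mul0r, mulr0) addr0 integral0_eq// => w _.
  by rewrite !(mul0r, mulr0).
transitivity (\int[P]_w ((K s * K r)%:E * (J s w * J r w)%:E))%E.
  by apply: eq_integral => w _; rewrite -EFinM /g/=; congr EFin; ring.
rewrite ge0_integralZl_EFin//.
- by rewrite mulJ// -EFinM; congr EFin; ring.
- by move=> w _; rewrite lee_fin mulr_ge0.
- by apply/measurable_EFinP; exact: measurable_funM.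
- by rewrite mulr_ge0.
Qed.

(** Only one factor of [Z * Z] is expanded at a time: Tonelli in [(s, w)] reduces to the mixed
    moment in [mean_JZ], where a second Tonelli, in [(r, w)], expands the other factor. *)
Lemma sqr_mean_weighted_integral (B : R) :
  (\int[mu]_s ((K s)%:E * \int[mu]_r (K r * Num.min s r)%:E) = B%:E)%E ->
  (\int[P]_w (Z w * Z w) = ((c1 * A) ^+ 2 + c2 * B)%:E)%E.
Proof.
move=> intB.
pose g (p : R * T) : \bar R := ((K p.1 * J p.1 p.2)%:E * Z p.2)%E.
have mg : measurable_fun setT g.
  apply: emeasurable_funM => //; apply: measurableT_comp; last exact: measurable_snd.
  exact: measurable_weighted_integral.
have g0 p : (0 <= g p)%E by rewrite mule_ge0 ?weighted_integral_ge0.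
transitivity (\int[P]_w \int[mu]_s g (s, w))%E.
  apply: eq_integral => w _; rewrite [X in (X * _)%E]/Z -ge0_integralZr//.
  - apply/measurable_EFinP; apply: measurable_funM => //.
    exact: (measurableT_comp mJ (measurable_pair2 w)).
  - by move=> s _; exact: (f0 (s, w)).
  - exact: weighted_integral_ge0.
rewrite -(@fubini_tonelli _ _ _ _ _ mu P _ mg g0)/=.
pose m s := (\int[mu]_r (K s * (K r * Num.min s r))%:E)%E.
have mm : measurable_fun setT m.
  apply: (measurable_fun_fubini_tonelli_F (m2 := mu) _ mkmin).
  by move=> [s r]; rewrite lee_fin kmin0.
have m0 s : (0 <= m s)%E by apply: integral_ge0 => r _; rewrite lee_fin.
have mE : (\int[mu]_s m s = B%:E)%E.
  rewrite -intB; apply: eq_integral => s _; rewrite /m; have [s0|s0] := ltP s 0.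
    by rewrite Kneg// mul0e integral0_eq// => r _; rewrite mul0r.
  under eq_integral do rewrite EFinM.
  rewrite ge0_integralZl_EFin//.
  - move=> r _; rewrite lee_fin; have [r0|r0] := ltP r 0; first by rewrite Kneg// mul0r.
    by rewrite mulr_ge0// le_min s0.
  - apply/measurable_EFinP; apply: measurable_funM => //.
    exact: measurable_minr.
have A0 : 0 <= A by rewrite -lee_fin -intK; apply: integral_ge0 => s _; rewrite lee_fin.
transitivity (\int[mu]_s ((c1 ^+ 2 * A)%:E * (K s * s)%:E + c2%:E * m s))%E.
  apply: eq_integral => s _; have [s0|s0] := ltP s 0; last first.
    by rewrite /g/= mean_JZ// -EFinM.
  rewrite /m Kneg// mul0r mule0 add0e integral0_eq; last first.
    by move=> w _; rewrite /g/= Kneg// mul0r mul0e.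
  by rewrite integral0_eq ?mule0// => r _; rewrite mul0r.
rewrite ge0_integralD//; last 4 first.
- by move=> s _; rewrite mule_ge0 ?lee_fin// mulr_ge0 ?sqr_ge0.
- exact: emeasurable_funM.
- by move=> s _; rewrite mule_ge0 ?lee_fin.
- exact: emeasurable_funM.
rewrite !ge0_integralZl_EFin//; [|by move=> s _; rewrite lee_fin|by rewrite mulr_ge0 ?sqr_ge0].
by rewrite mE intK -!EFinM -EFinD; congr EFin; ring.
Qed.

End RL_integral_moments.

Section RL_kernel_weight.
Context {R : realType}.
Notation mu := (@lebesgue_measure R).

(** Finiteness is all that is asked of this integral, since the squared mean cancels in the
    variance. On the support of the kernel [s <= t], which bounds it by [t] times the mass of the
    kernel. *)
Lemma integral_RL_kernel_id (a t : R) : 0 < a -> 0 <= t ->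
  exists A, (\int[mu]_s (RL_kernel a t s * s)%:E = A%:E)%E.
Proof.
move=> a0 t0; set I := (\int[mu]_s _)%E.
have I0 : (0 <= I)%E.
  apply: integral_ge0 => s _; rewrite lee_fin.
  by rewrite /RL_kernel; case: ifPn => [/andP[s0 _]|_]; rewrite ?mul0r// mulr_ge0 ?powR_ge0.
suff Ioo : (I < +oo)%E by exists (fine I); rewrite fineK// ge0_fin_numE.
have mK := @measurable_RL_kernel R a t.
apply: (@le_lt_trans _ _ (\int[mu]_(s in `]0%R, +oo[) (t%:E * (RL_kernel a t s)%:E))%E).
  rewrite (integral_ifT (b := fun s : R => 0 < s)); last first.
    by move=> s; rewrite /= in_itv/= andbT.
  apply: ge0_le_integral => //.
  - move=> s _; rewrite lee_fin /RL_kernel.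
    by case: ifPn => [/andP[s0 _]|_]; rewrite ?mul0r// mulr_ge0 ?powR_ge0.
  - by apply/measurable_EFinP; exact: measurable_funM.
  - apply: measurable_fun_ifT => //; first exact: measurable_fun_ltr.
    by apply: emeasurable_funM => //; exact/measurable_EFinP.
  - move=> s _; case: ifPn => s0; last first.
      rewrite lee_fin /RL_kernel; case: ifPn => [/andP[s0' _]|_]; last by rewrite mul0r.
      by have -> : s = 0; [lra|rewrite mulr0].
    rewrite -EFinM lee_fin mulrC /RL_kernel; case: ifPn => [/andP[_ st]|_].
      by rewrite ler_wpM2r ?powR_ge0.
    by rewrite !mulr0.
rewrite ge0_integralZl_EFin//.
- by rewrite integral_RL_kernel// -EFinM ltry.
- by move=> s _; rewrite lee_fin RL_kernel_ge0.
- by apply/measurable_EFinP; exact: measurable_funTS.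
Qed.

Lemma RL_integralE (a t : R) (f : R -> R) :
  RL_integral a f t = (Gamma a)^-1 * fine (\int[mu]_s (RL_kernel a t s * f s)%:E)%E.
Proof.
rewrite /RL_integral /Rintegral; congr (_ * fine _).
rewrite [LHS](integral_ifT (b := fun s : R => (0 <= s) && (s <= t))); last first.
  by move=> s; rewrite /= in_itv/=.
by apply: eq_integral => s _; rewrite /RL_kernel; case: ifP => // _; rewrite mul0r.
Qed.

Lemma Gamma_ge0 (a : R) : 0 <= Gamma a.
Proof. by apply: Rintegral_ge0 => x _; rewrite mulr_ge0 ?powR_ge0 ?expR_ge0. Qed.

End RL_kernel_weight.

Theorem theorem6p2 (d : measure_display) (T : measurableType d) (R : realType)
    (P : probability T R) (k : nat) (l : nat -> R) (M : R -> {RV P >-> R})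
    (alpha : R)
    (hk : (0 < k)%N)
    (hl : forall j, (1 <= j <= k)%N -> 0 < l j)
    (hM : is_gcp k l M)
    (halpha : 0 < alpha) :
  forall t : R, 0 <= t ->
    'V_P[fun w => RL_integral alpha (M ^~ w) t] =
    ((\sum_(1 <= j < k.+1) j%:R ^+ 2 * l j) * t `^ (2 * alpha + 1)
      / ((2 * alpha + 1) * Gamma (alpha + 1) ^+ 2))%:E.
Proof.
move=> t t0.
have [N [mN N0 subN]] := levy_cadlag (gcp_levy hM).
have mCN : measurable (~` N) by exact: measurableC.
(* Replacing the paths by zero on the measurable null set [N] that contains all irregular ones makes
   every path right-continuous. *)
pose X s w := M s w * \1_(~` N) w.
have XE s w : ~ N w -> X s w = M s w.
  by move=> Nw; rewrite /X indicE mem_set// mulr1.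
have X_N s w : N w -> X s w = 0.
  by move=> Nw; rewrite /X indicE memNset ?mulr0//; exact.
pose D := [set p : R * T | 0 <= p.1].
(* A further cut to zero at negative times yields nonnegativity and joint measurability on the whole
   of [R * T]. *)
pose J s w := ((fun p : R * T => X p.1 p.2) \_ D) (s, w).
have JE s w : 0 <= s -> J s w = X s w by move=> s0; rewrite /J patchE mem_set.
have X0 s w : 0 <= s -> 0 <= X s w.
  by move=> s0; rewrite mulr_ge0 ?indicE// (gcp_ge0 hM).
have J0 s w : 0 <= J s w.
  by rewrite /J patchE; case: ifPn => // /set_mem /= s0; exact: X0.
have mX s : measurable_fun setT (X s).
  by apply: measurable_funM => //; exact: measurable_funPT.
have mD : measurable D.
  rewrite (_ : D = `[0, +oo[%classic `*` setT); first exact: measurableX.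
  by apply/seteqP; split => -[s w]; rewrite /D /= in_itv/= andbT// => -[].
have mJ : measurable_fun setT (fun p : R * T => J p.1 p.2).
  rewrite (_ : (fun p => _) = (fun p : R * T => X p.1 p.2) \_ D); last first.
    by apply/funext => -[].
  apply/(measurable_restrictT _ mD); apply: measurable_right_continuous => // s w s0.
  have [Nw|Nw] := pselect (N w).
    by rewrite X_N//; under eq_cvg do rewrite X_N//; exact: cvg_cst.
  rewrite XE//; under eq_cvg do rewrite XE//.
  have : (forall s, 0 <= s -> (M ^~ w) r @[r --> s^'+] --> M s w) /\
      (forall s, 0 < s -> cvg ((M ^~ w) r @[r --> s^'-])).
    by apply: contrapT => /subN.
  by move=> [+ _]; exact.
pose c1 := \sum_(1 <= j < k.+1) j%:R * l j.
pose c2 := \sum_(1 <= j < k.+1) j%:R ^+ 2 * l j.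
have c1_ge0 : 0 <= c1.
  rewrite /c1 big_nat; apply: sumr_ge0 => j; rewrite ltnS => jk.
  by rewrite mulr_ge0// ltW// hl.
have c2_ge0 : 0 <= c2.
  rewrite /c2 big_nat; apply: sumr_ge0 => j; rewrite ltnS => jk.
  by rewrite mulr_ge0 ?sqr_ge0// ltW// hl.
have meanJ s : 0 <= s -> (\int[P]_w (J s w)%:E = (c1 * s)%:E)%E.
  move=> s0; rewrite -(gcp_mean hM s0).
  apply: (ge0_eq_integral_off_null mN N0) => w.
  - by rewrite lee_fin.
  - by rewrite lee_fin (gcp_ge0 hM).
  - by move=> Nw; rewrite JE// XE.
have mulJ s r : 0 <= s -> 0 <= r -> (\int[P]_w (J s w * J r w)%:E =
    (c1 ^+ 2 * s * r + c2 * Num.min s r)%:E)%E.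
  move=> s0 r0; rewrite -(gcp_mul_mean hM s0 r0).
  apply: (ge0_eq_integral_off_null mN N0) => w.
  - by rewrite lee_fin mulr_ge0.
  - by rewrite lee_fin mulr_ge0 ?(gcp_ge0 hM).
  - by move=> Nw; rewrite !JE// !XE.
have K0 := @RL_kernel_ge0 R alpha t.
have mK := @measurable_RL_kernel R alpha t.
have Kneg s : s < 0 -> RL_kernel alpha t s = 0.
  by move=> s0; rewrite /RL_kernel leNgt s0.
have [A intA] := integral_RL_kernel_id halpha t0.
have intB := integral_RL_kernel_min halpha t0.
pose Z w := (\int[lebesgue_measure]_s (RL_kernel alpha t s * J s w)%:E)%E.
rewrite (@variance_off_null _ _ _ P N Z _ (Gamma alpha)^-1 (c1 * A)
  ((c1 * A) ^+ 2 + c2 * (t `^ (2 * alpha + 1) / (alpha ^+ 2 * (2 * alpha + 1)))))//.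
(* [(c1 * A) ^+ 2] cancels, and the [alpha ^+ 2] left by the double integral of the kernel joins
   [Gamma alpha ^+ 2] to form [Gamma (alpha + 1) ^+ 2]. *)
- congr EFin; rewrite -/c2 Gamma_recurrence// addrC addKr.
  rewrite [in RHS]exprMn !invfM; ring.
- exact: measurable_weighted_integral.
- by move=> w; exact: weighted_integral_ge0.
- by rewrite invr_ge0 Gamma_ge0.
- move=> w; rewrite RL_integralE mulr_ge0 ?invr_ge0 ?Gamma_ge0// fine_ge0//.
  apply: integral_ge0 => s _; rewrite lee_fin; have [s0|s0] := ltP s 0.
    by rewrite Kneg// mul0r.
  by rewrite mulr_ge0// (gcp_ge0 hM).
- move=> w Nw; rewrite RL_integralE; congr (_ * fine _); apply: eq_integral => s _.
  have [s0|s0] := ltP s 0; first by rewrite Kneg// !mul0r.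
  by rewrite JE// XE.
- exact: mean_weighted_integral.
- exact: sqr_mean_weighted_integral.
Qed.
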